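(* Let $F_n$ be the free group of finite rank $n$ and let $H$ be a finitely generated subgroup of $F_n$. Then the set of cyclically reduced $\oplus$-cocycles of $H$, namely $\mathrm{Coc}_{\oplus}(H)\cap \mathcal{C}_n$, is a rational subset of $F_n$, and one can effectively compute (from a finite generating set of $H$) a finite automaton recognizing it.
   Context: $F_n$ is the free group with basis $A=\{a_1,\dots,a_n\}$; its elements are identified with freely reduced words over $A^{\pm}=A\sqcup A^{-1}$. $\mathcal{C}_n$ denotes the set of cyclically reduced words over $A^{\pm}$ (reduced words whose first and last letters are not inverse to each other; the empty word is included). For $H\leqslant F_n$, $\mathrm{Coc}_{\oplus}(H)=\{u\in F_n : \langle H\cup\{u\}\rangle=F_n \text{ and } H\cap\langle u\rangle=\{1\}\}$. A subset of $F_n$ is rational if the set of reduced words representing its elements is a rational (regular) language over $A^{\pm}$ (by Benois' theorem this agrees with the usual notion of rational subset of the group $F_n$). *)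

(* Defs.v *)
From HB Require Import structures.
From mathcomp Require Import all_boot.
From mathcomp Require Import boolp classical_sets.

Set Implicit Arguments.
Unset Strict Implicit.
Unset Printing Implicit Defensive.

Local Open Scope classical_set_scope.
Local Open Scope group_scope.

(* [(i, true)] is the basis element a_i and [(i, false)] its inverse. *)
Notation letter n := ('I_n * bool)%type.

Definition inv_letter n (x : letter n) : letter n := (x.1, ~~ x.2).

Definition reduced n (w : seq (letter n)) : bool :=
  sorted (fun x y => y != inv_letter x) w.

Definition push n (x : letter n) (w : seq (letter n)) : seq (letter n) :=
  if w is y :: w' then if y == inv_letter x then w' else x :: w else [:: x].

Definition reduce n (w : seq (letter n)) : seq (letter n) :=
  foldr (@push n) [::] w.

Definition inv_word n (w : seq (letter n)) : seq (letter n) :=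
  rev (map (@inv_letter n) w).

Record free_group (n : nat) := FreeGroup {
  word_of :> seq (letter n);
  _ : reduced word_of
}.

HB.instance Definition _ n := [isSub for @word_of n].
HB.instance Definition _ n := [Choice of free_group n by <:].

Section FreeGroupLaws.

Variable n : nat.
Implicit Types (x y : letter n) (u v w : seq (letter n)).

Fact inv_letterK : involutive (@inv_letter n).
Proof. by case=> i b; rewrite /inv_letter /= negbK. Qed.

Fact reduced_cons x w : reduced (x :: w) -> reduced w.
Proof. exact: path_sorted. Qed.

Fact push_reduced x w : reduced w -> reduced (push x w).
Proof.
case: w => [|y w] //= yw; case: eqP => [_|/eqP nxy]; first exact: path_sorted yw.
by rewrite /reduced /= nxy.
Qed.

Fact pushes_reduced u v : reduced v -> reduced (foldr (@push n) v u).
Proof. by move=> rv; elim: u => //= x u; apply: push_reduced. Qed.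

Fact reduce_reduced w : reduced (reduce w).
Proof. exact: pushes_reduced. Qed.

Fact push_id x w : reduced (x :: w) -> push x w = x :: w.
Proof. by case: w => //= y w /andP[/negPf-> _]. Qed.

Fact reduce_id w : reduced w -> reduce w = w.
Proof.
elim: w => //= x w IHw rxw; rewrite IHw ?push_id //.
exact: reduced_cons rxw.
Qed.

Fact pushK x w : reduced w -> push x (push (inv_letter x) w) = w.
Proof.
case: w => [|y w] /=; first by rewrite eqxx.
rewrite inv_letterK; case: eqP => [-> rw|_ _]; first by rewrite push_id.
by rewrite /= eqxx.
Qed.

Fact foldr_push x u w :
  reduced w -> foldr (@push n) w (push x u) = push x (foldr (@push n) w u).
Proof.
case: u => [|y u] //= rw; case: eqP => [->|//].
by rewrite pushK // pushes_reduced.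
Qed.

Fact reduce_cat u v : reduce (u ++ v) = foldr (@push n) (reduce v) u.
Proof. by rewrite /reduce foldr_cat. Qed.

Fact reduce_catl u v : reduce (reduce u ++ v) = reduce (u ++ v).
Proof.
rewrite !reduce_cat; elim: u => //= x u <-.
by rewrite foldr_push // reduce_reduced.
Qed.

Fact reduce_catr u v : reduce (u ++ reduce v) = reduce (u ++ v).
Proof. by rewrite !reduce_cat [reduce (reduce v)]reduce_id // reduce_reduced. Qed.

Fact inv_word_reduced w : reduced w -> reduced (inv_word w).
Proof.
rewrite /reduced /inv_word rev_sorted sorted_map; apply: sub_sorted => x y.
by apply: contraNneq => /= ->; rewrite inv_letterK.
Qed.

Fact inv_wordK : involutive (@inv_word n).
Proof.
by move=> w; rewrite /inv_word map_rev revK -map_comp map_id_in // => x _ /=; rewrite inv_letterK.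
Qed.

Fact reduce_catV w : reduce (w ++ inv_word w) = [::].
Proof.
elim: w => //= x w IHw; rewrite /inv_word /= rev_cons -cats1 catA.
rewrite -reduce_catl IHw /= eqxx //.
Qed.

Fact reduce_Vcat w : reduce (inv_word w ++ w) = [::].
Proof. by rewrite -{2}[w]inv_wordK reduce_catV. Qed.

Definition fg_one : free_group n := @FreeGroup n [::] isT.

Definition fg_mul (u v : free_group n) : free_group n :=
  FreeGroup (reduce_reduced (u ++ v)).

Definition fg_inv (u : free_group n) : free_group n :=
  FreeGroup (inv_word_reduced (valP u)).

Fact fg_mulA : associative fg_mul.
Proof.
by move=> u v w; apply: val_inj; rewrite /= reduce_catr reduce_catl catA.
Qed.

Fact fg_mul1 : left_id fg_one fg_mul.
Proof. by move=> u; apply: val_inj; rewrite /= reduce_id // (valP u). Qed.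

Fact fg_mulr1 : right_id fg_one fg_mul.
Proof. by move=> u; apply: val_inj; rewrite /= cats0 reduce_id // (valP u). Qed.

Fact fg_mulV : left_inverse fg_one fg_inv fg_mul.
Proof. by move=> u; apply: val_inj; rewrite /= reduce_Vcat. Qed.

Fact fg_mulrV : right_inverse fg_one fg_inv fg_mul.
Proof. by move=> u; apply: val_inj; rewrite /= reduce_catV. Qed.

HB.instance Definition _ := isGroup.Build (free_group n)
  fg_mulA fg_mul1 fg_mulr1 fg_mulV fg_mulrV.

End FreeGroupLaws.

Definition is_subgroup (G : groupType) (H : set G) : Prop :=
  group_closed (mem H).

Definition gen (G : groupType) (X : set G) : set G :=
  smallest (@is_subgroup G) X.

Definition finitely_generated (G : groupType) (H : set G) : Prop :=
  exists s : seq G, H = gen [set` s].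

Definition cyclically_reduced n (w : seq (letter n)) : bool :=
  reduced w && (if w is x :: w' then last x w' != inv_letter x else true).

Definition cyc_reduced_set n : set (free_group n) :=
  [set u | cyclically_reduced u].

Definition coc_oplus (G : groupType) (H : set G) : set G :=
  [set u | gen (H `|` [set u]) = [set: G] /\ H `&` gen [set u] = [set 1]].

(* A nondeterministic finite automaton.  Its finitely many states are the
   numbers occurring in the three lists. *)
Record automaton (n : nat) := Automaton {
  initials : seq nat;
  finals : seq nat;
  transitions : seq (nat * letter n * nat)
}.

Fixpoint accepts_from n (A : automaton n) (p : nat) (w : seq (letter n)) : Prop :=
  if w is x :: w' then
    exists2 q, (p, x, q) \in transitions A & accepts_from A q w'
  else p \in finals A.

Definition accepts n (A : automaton n) (w : seq (letter n)) : Prop :=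
  exists2 p, p \in initials A & accepts_from A p w.

(* The accepted language is exactly the set of reduced words of the elements
   of X; in particular no word that is not reduced is accepted. *)
Definition recognizes n (A : automaton n) (X : set (free_group n)) : Prop :=
  forall w : seq (letter n), accepts A w <-> exists2 u, X u & word_of u = w.

Definition rational n (X : set (free_group n)) : Prop :=
  exists A : automaton n, recognizes A X.

(* Model of computation: the WHILE language over binary trees (Jones,
   "Computability and Complexity from a Programming Perspective"), written
   without variables: a program transforms a single tree, which serves as its
   store.  It is Turing-complete; [Leaf] plays the role of "false". *)
Inductive tree := Leaf | Node of tree & tree.

Inductive prog :=
  | PId
  | PLeaf
  | PNode of prog & prog
  | PLeft
  | PRight
  | PSeq of prog & prog
  | PIf of prog & prog & prog
  | PWhile of prog & prog.

Definition left_of (t : tree) : tree := if t is Node a _ then a else Leaf.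
Definition right_of (t : tree) : tree := if t is Node _ b then b else Leaf.

(* [eval P s t]: on input [s] the program [P] halts with output [t]. *)
Inductive eval : prog -> tree -> tree -> Prop :=
  | eval_id s : eval PId s s
  | eval_leaf s : eval PLeaf s Leaf
  | eval_node P Q s a b : eval P s a -> eval Q s b -> eval (PNode P Q) s (Node a b)
  | eval_left s : eval PLeft s (left_of s)
  | eval_right s : eval PRight s (right_of s)
  | eval_seq P Q s t r : eval P s t -> eval Q t r -> eval (PSeq P Q) s r
  | eval_if_true C P Q s a b t :
      eval C s (Node a b) -> eval P s t -> eval (PIf C P Q) s t
  | eval_if_false C P Q s t : eval C s Leaf -> eval Q s t -> eval (PIf C P Q) s t
  | eval_while_stop C P s : eval C s Leaf -> eval (PWhile C P) s s
  | eval_while_step C P s a b t r :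
      eval C s (Node a b) -> eval P s t -> eval (PWhile C P) t r ->
      eval (PWhile C P) s r.

Definition enc_nat (k : nat) : tree := iter k (Node Leaf) Leaf.

Definition enc_bool (b : bool) : tree := if b then Node Leaf Leaf else Leaf.

Definition enc_seq (T : Type) (enc : T -> tree) (s : seq T) : tree :=
  foldr (fun x t => Node (enc x) t) Leaf s.

Definition enc_letter n (x : letter n) : tree := Node (enc_nat x.1) (enc_bool x.2).

Definition enc_word n (w : seq (letter n)) : tree := enc_seq (@enc_letter n) w.

Definition enc_transition n (e : nat * letter n * nat) : tree :=
  let: (p, x, q) := e in Node (enc_nat p) (Node (enc_letter x) (enc_nat q)).

Definition enc_automaton n (A : automaton n) : tree :=
  Node (enc_seq enc_nat (initials A))
    (Node (enc_seq enc_nat (finals A)) (enc_seq (@enc_transition n) (transitions A))).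

Definition enc_generators n (s : seq (free_group n)) : tree :=
  Node (enc_nat n) (enc_seq (fun u : free_group n => enc_word u) s).

(* Main.v *)
Require Import Defs.
From mathcomp Require Import all_boot boolp classical_sets.

(* Write H = <s>.  The suffixes of the generators and of the one-letter words
   span a finite subgraph of the Cayley graph; identifying every generator with
   the empty word and folding gives a finite deterministic inverse graph whose
   closed paths at the base vertex are the elements of H, and in which every
   letter can be read from the base vertex.  If a reduced word u is not of the
   form pq with p readable from the base vertex and q readable to it, then a
   path labelled u can be added to the graph without any folding, so <H, u>
   misses a letter.  If u = pq with p ending at P and q starting at Q, then
   <H, u> is read in the graph obtained by identifying P and Q, and <H, u> is the
   whole group iff this identification folds the graph to a single vertex.  For u
   cyclically reduced, u^k is a reduced word, so H meets <u> trivially iff the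
   orbit of the base vertex under the partial injection induced by u never
   returns.  All these conditions depend only on finitely many relations on the
   vertices, which the recognizing automaton updates letter by letter.

   Since complexity is irrelevant, closures are not computed by iteration: the
   folding congruence is the intersection of all congruences found among all
   lists of pairs of vertices. *)

Set Implicit Arguments.
Unset Strict Implicit.
Unset Printing Implicit Defensive.

(** * Functions computed by WHILE programs *)

(** The instances repeat the encodings of the statement, so that the input and output trees there
    become values of [encode]. *)
Class encodable (A : Type) := encode : A -> tree.

Instance encodable_tree : encodable tree := id.
Instance encodable_nat : encodable nat := enc_nat.
Instance encodable_bool : encodable bool := enc_bool.
Instance encodable_prod A B `{encodable A} `{encodable B} : encodable (A * B) :=
  fun p => Node (encode p.1) (encode p.2).
Instance encodable_seq A `{encodable A} : encodable (seq A) := enc_seq encode.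

(** Programs can only compare trees, so testing equality of data needs an injective encoding. *)
Class encoding_inj A (eA : encodable A) := encode_inj : injective (@encode A eA).
Arguments encoding_inj A {eA}.

Instance enc_nat_inj : encoding_inj nat.
Proof. by elim=> [|i IHi] [|j] //= [/IHi->]. Qed.

Instance enc_bool_inj : encoding_inj bool.
Proof. by case=> [] []. Qed.

Instance enc_prod_inj A B `{encoding_inj A} `{encoding_inj B} : encoding_inj (A * B)%type.
Proof. by move=> [a b] [a' b'] [eqa eqb]; congr (_, _); apply: encode_inj. Qed.

Instance enc_seq_inj A `{encoding_inj A} : encoding_inj (seq A).
Proof. by elim=> [|a s IHs] [|b t] //= [eqa /IHs->]; congr (_ :: _); apply: encode_inj. Qed.

(** In the closure lemmas, [G] is a context holding the values of the free variables; as programs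
    have no variables, a bound variable is paired with the context. *)
Definition computable A B `{encodable A} `{encodable B} (f : A -> B) :=
  exists P, forall a, eval P (encode a) (encode (f a)).

Section Computable.

Context {G : Type} `{encodable G}.

Lemma computable_ext A `{encodable A} (f g : G -> A) :
  f =1 g -> computable f -> computable g.
Proof. by move=> fg [P evP]; exists P => a; rewrite -fg. Qed.

Lemma computable_comp A B `{encodable A} `{encodable B} (f : G -> A) (g : A -> B) :
  computable g -> computable f -> computable (fun c => g (f c)).
Proof. by move=> [P evP] [Q evQ]; exists (PSeq Q P) => c; apply: eval_seq. Qed.

Lemma computable_id : computable (fun c : G => c).
Proof. by exists PId => c; apply: eval_id. Qed.

Lemma computable_fst A B `{encodable A} `{encodable B} (f : G -> A * B) :
  computable f -> computable (fun c => (f c).1).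
Proof. by apply: computable_comp; exists PLeft => a; apply: eval_left (encode a). Qed.

Lemma computable_snd A B `{encodable A} `{encodable B} (f : G -> A * B) :
  computable f -> computable (fun c => (f c).2).
Proof. by apply: computable_comp; exists PRight => a; apply: eval_right (encode a). Qed.

Lemma computable_pair A B `{encodable A} `{encodable B} (f : G -> A) (g : G -> B) :
  computable f -> computable g -> computable (fun c => (f c, g c)).
Proof. by move=> [P evP] [Q evQ]; exists (PNode P Q) => c; apply: eval_node. Qed.

Lemma computable_nil A `{encodable A} : computable (fun _ : G => [::] : seq A).
Proof. by exists PLeaf => c; apply: eval_leaf. Qed.

Lemma computable_cons A `{encodable A} (f : G -> A) (g : G -> seq A) :
  computable f -> computable g -> computable (fun c => f c :: g c).
Proof. by move=> [P evP] [Q evQ]; exists (PNode P Q) => c; apply: eval_node. Qed.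

Lemma computable_0 : computable (fun _ : G => 0).
Proof. by exists PLeaf => c; apply: eval_leaf. Qed.

Lemma computable_S (f : G -> nat) : computable f -> computable (fun c => (f c).+1).
Proof.
move=> [P evP]; exists (PNode PLeaf P) => c.
by apply: eval_node => //; apply: eval_leaf.
Qed.

Lemma computable_false : computable (fun _ : G => false).
Proof. by exists PLeaf => c; apply: eval_leaf. Qed.

Lemma computable_true : computable (fun _ : G => true).
Proof. by exists (PNode PLeaf PLeaf) => c; apply: eval_node; apply: eval_leaf. Qed.

Lemma computable_if A `{encodable A} (b : G -> bool) (f g : G -> A) :
  computable b -> computable f -> computable g ->
  computable (fun c => if b c then f c else g c).
Proof.
move=> [C evC] [P evP] [Q evQ]; exists (PIf C P Q) => c.
by have := evC c; case: (b c) => evb; [apply: eval_if_true evb _|apply: eval_if_false].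
Qed.

(** All later iteration over lists is reduced to this single loop. *)
Lemma computable_foldl A B `{encodable A} `{encodable B}
    (f : G -> B -> A -> B) (z : G -> B) (s : G -> seq A) :
  computable (fun p : G * B * A => f p.1.1 p.1.2 p.2) ->
  computable z -> computable s -> computable (fun c => foldl (f c) (z c) (s c)).
Proof.
move=> [P evP] [Q evQ] [S evS].
(* The store is (context, (remaining list, accumulator)). One round drops the head of the list and
   runs [P] on ((context, accumulator), head); the loop ends when the list is [Leaf]. *)
pose body := PNode PLeft (PNode (PSeq PRight (PSeq PLeft PRight))
  (PSeq (PNode (PNode PLeft (PSeq PRight PRight)) (PSeq PRight (PSeq PLeft PLeft))) P)).
pose loop := PWhile (PSeq PRight PLeft) body.
exists (PSeq (PNode PId (PNode S Q)) (PSeq loop (PSeq PRight PRight))) => c.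
have getR t : eval PRight t (right_of t) by apply: eval_right.
have getL t : eval PLeft t (left_of t) by apply: eval_left.
have evloop t b :
    eval loop (Node (encode c) (Node (encode t) (encode b)))
      (Node (encode c) (Node Leaf (encode (foldl (f c) b t)))).
  elim: t b => [|a t IHt] b /=.
    by apply: eval_while_stop; apply: eval_seq (getR _) (getL _).
  apply: (eval_while_step _ _ (IHt _)).
    exact: eval_seq (getR _) (getL _).
  apply: eval_node; first exact: getL.
  apply: eval_node; first exact: eval_seq (getR _) (eval_seq (getL _) (getR _)).
  apply: eval_seq (evP (c, b, a)).
  apply: eval_node; last exact: eval_seq (getR _) (eval_seq (getL _) (getL _)).
  by apply: eval_node; [exact: getL|exact: eval_seq (getR _) (getR _)].
apply: eval_seq (eval_seq (evloop _ _) (eval_seq (getR _) (getR _))).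
by apply: eval_node; [apply: eval_id|apply: eval_node].
Qed.

Lemma computable_eq (A : eqType) {eA : encodable A} {iA : encoding_inj A} (f g : G -> A) :
  computable f -> computable g -> computable (fun c => f c == g c).
Proof.
move=> [P evP] [Q evQ].
(* The store is (stack of pairs of trees still to be compared, answer). A pair of nodes is replaced
   by the two pairs of subtrees, a pair of leaves is dropped, and a mismatch empties the stack and
   sets the answer to [Leaf]. *)
pose true_ := PNode PLeaf PLeaf.
pose fst_ := PSeq PLeft (PSeq PLeft PLeft).
pose snd_ := PSeq PLeft (PSeq PLeft PRight).
pose rest_ := PSeq PLeft PRight.
pose fail_ := PNode PLeaf PLeaf.
pose body := PIf fst_
  (PIf snd_
    (PNode (PNode (PNode (PSeq fst_ PLeft) (PSeq snd_ PLeft))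
      (PNode (PNode (PSeq fst_ PRight) (PSeq snd_ PRight)) rest_)) PRight) fail_)
  (PIf snd_ fail_ (PNode rest_ PRight)).
pose loop := PWhile PLeft body.
exists (PSeq (PNode (PNode (PNode P Q) PLeaf) true_) (PSeq loop PRight)) => c.
have getR t : eval PRight t (right_of t) by apply: eval_right.
have getL t : eval PLeft t (left_of t) by apply: eval_left.
have getF a b s r : eval fst_ (Node (Node (Node a b) s) r) a.
  exact: eval_seq (getL _) (eval_seq (getL _) (getL _)).
have getS a b s r : eval snd_ (Node (Node (Node a b) s) r) b.
  exact: eval_seq (getL _) (eval_seq (getL _) (getR _)).
have getT a b s r : eval rest_ (Node (Node (Node a b) s) r) s.
  exact: eval_seq (getL _) (getR _).
have ev_fail s : eval fail_ s (Node Leaf Leaf) by apply: eval_node; apply: eval_leaf.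
(* Continuation style: the two hypotheses say how the loop ends once the top pair is found equal or
   unequal, so structural induction on [a] suffices. *)
have evloop a : forall b s r t,
    (a = b -> eval loop (Node s r) t) ->
    (a <> b -> eval loop (Node Leaf Leaf) t) ->
  eval loop (Node (Node (Node a b) s) r) t.
  elim: a => [|a1 IH1 a2 IH2] [|b1 b2] s r t eq_ab neq_ab;
    apply: eval_while_step; try exact: getL.
  - apply: eval_if_false; first exact: getF.
    apply: eval_if_false; first exact: getS.
    by apply: eval_node; [apply: getT|apply: getR].
  - exact: eq_ab.
  - apply: eval_if_false; first exact: getF.
    by apply: eval_if_true; first exact: getS.
  - exact: neq_ab.
  - apply: eval_if_true; first exact: getF.
    by apply: eval_if_false; first exact: getS.
  - exact: neq_ab.
  - apply: eval_if_true; first exact: getF.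
    apply: eval_if_true; first exact: getS.
    apply: eval_node; last exact: getR.
    apply: eval_node; last apply: eval_node; last exact: getT.
      by apply: eval_node; [apply: eval_seq (getF _ _ _ _) (getL _)
                          |apply: eval_seq (getS _ _ _ _) (getL _)].
    by apply: eval_node; [apply: eval_seq (getF _ _ _ _) (getR _)
                         |apply: eval_seq (getS _ _ _ _) (getR _)].
  - apply: (IH1) => [eq1|neq1]; last by apply: neq_ab => -[].
    apply: (IH2) => [eq2|neq2]; last by apply: neq_ab => -[].
    by apply: eq_ab; rewrite eq1 eq2.
have evstop r : eval loop (Node Leaf r) (Node Leaf r).
  by apply: eval_while_stop; apply: getL.
apply: (@eval_seq _ _ _ (Node (Node (Node (encode (f c)) (encode (g c))) Leaf) (Node Leaf Leaf))).
  apply: eval_node; last by apply: eval_node; apply: eval_leaf.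
  by apply: eval_node (eval_leaf _); apply: eval_node.
apply: (@eval_seq _ _ _ (Node Leaf (enc_bool (f c == g c)))); last exact: getR.
apply: evloop => [/(@encode_inj A eA iA)->|neq]; first by rewrite eqxx.
by case: eqP neq => [->|].
Qed.

End Computable.

Lemma computable_rev G `{encodable G} A `{encodable A} (s : G -> seq A) :
  computable s -> computable (fun c => rev (s c)).
Proof.
move=> cs; apply: (@computable_ext _ _ _ _ (fun c => foldl (fun t x => x :: t) [::] (s c))).
  by move=> c; rewrite /rev; elim: (s c) [::] => //=.
apply: computable_foldl cs; last exact: computable_nil.
apply: computable_cons; first exact/computable_snd/computable_id.
exact/computable_snd/computable_fst/computable_id.
Qed.

Lemma computable_foldr G `{encodable G} A B `{encodable A} `{encodable B}
    (f : G -> A -> B -> B) (z : G -> B) (s : G -> seq A) :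
  computable (fun p : G * A * B => f p.1.1 p.1.2 p.2) ->
  computable z -> computable s -> computable (fun c => foldr (f c) (z c) (s c)).
Proof.
move=> cf cz cs.
apply: (@computable_ext _ _ _ _ (fun c => foldl (fun b a => f c a b) (z c) (rev (s c)))).
  by move=> c; rewrite foldl_rev.
apply: computable_foldl (computable_rev cs) => //.
pose swap (p : G * B * A) := (p.1.1, p.2, p.1.2).
apply: (@computable_comp _ _ _ _ _ _ swap _ cf).
have cid : computable (fun p : G * B * A => p) by apply: computable_id.
have cid1 := computable_fst cid.
apply: computable_pair (computable_snd cid1).
exact: computable_pair (computable_fst cid1) (computable_snd cid).
Qed.

Lemma computable_cat G `{encodable G} A `{encodable A} (s t : G -> seq A) :
  computable s -> computable t -> computable (fun c => s c ++ t c).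
Proof.
move=> cs ct; apply: (computable_ext (f := fun c => foldr cons (t c) (s c))).
  by move=> c; elim: (s c) => //= x u ->.
apply: computable_foldr ct cs; apply: computable_cons.
  exact/computable_snd/computable_fst/computable_id.
exact/computable_snd/computable_id.
Qed.

Lemma computable_flatten G `{encodable G} A `{encodable A} (s : G -> seq (seq A)) :
  computable s -> computable (fun c => flatten (s c)).
Proof.
move=> cs; apply: computable_foldr cs; last exact: computable_nil.
apply: computable_cat; last exact/computable_snd/computable_id.
exact/computable_snd/computable_fst/computable_id.
Qed.

Lemma computable_map G `{encodable G} A B `{encodable A} `{encodable B}
    (f : G -> A -> B) (s : G -> seq A) :
  computable (fun p : G * A => f p.1 p.2) -> computable s ->
  computable (fun c => map (f c) (s c)).
Proof.
move=> cf cs; apply: (computable_ext (f := fun c => foldr (fun a t => f c a :: t) [::] (s c))).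
  by move=> c; elim: (s c) => //= x u ->.
apply: computable_foldr cs; last exact: computable_nil.
apply: computable_cons; last exact/computable_snd/computable_id.
exact: (computable_comp cf (computable_fst computable_id)).
Qed.

Lemma computable_filter G `{encodable G} A `{encodable A} (p : G -> pred A) (s : G -> seq A) :
  computable (fun q : G * A => p q.1 q.2) -> computable s ->
  computable (fun c => [seq a <- s c | p c a]).
Proof.
move=> cp cs.
apply: (computable_ext (f := fun c => foldr (fun a t => if p c a then a :: t else t) [::] (s c))).
  by move=> c; elim: (s c) => //= x u ->.
apply: computable_foldr cs; last exact: computable_nil.
have ctail : computable (fun q : G * A * seq A => q.2) by exact/computable_snd/computable_id.
apply: computable_if => //; first exact: (computable_comp cp (computable_fst computable_id)).
by apply: computable_cons => //; exact/computable_snd/computable_fst/computable_id.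
Qed.

Lemma computable_negb G `{encodable G} (b : G -> bool) :
  computable b -> computable (fun c => ~~ b c).
Proof.
by move=> cb; apply: computable_if cb _ _; [apply: computable_false|apply: computable_true].
Qed.

Lemma computable_andb G `{encodable G} (a b : G -> bool) :
  computable a -> computable b -> computable (fun c => a c && b c).
Proof. by move=> ca cb; apply: computable_if ca cb _; apply: computable_false. Qed.

Lemma computable_orb G `{encodable G} (a b : G -> bool) :
  computable a -> computable b -> computable (fun c => a c || b c).
Proof. by move=> ca cb; apply: computable_if ca _ cb; apply: computable_true. Qed.

Lemma computable_implyb G `{encodable G} (a b : G -> bool) :
  computable a -> computable b -> computable (fun c => a c ==> b c).
Proof. by move=> ca cb; apply: computable_if ca cb _; apply: computable_true. Qed.

Lemma computable_has G `{encodable G} A `{encodable A} (p : G -> pred A) (s : G -> seq A) :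
  computable (fun q : G * A => p q.1 q.2) -> computable s ->
  computable (fun c => has (p c) (s c)).
Proof.
move=> cp cs.
apply: (computable_ext (f := fun c => foldr (fun a b => p c a || b) false (s c))) => //.
apply: computable_foldr cs; last exact: computable_false.
apply: computable_orb; last exact/computable_snd/computable_id.
exact: (computable_comp cp (computable_fst computable_id)).
Qed.

Lemma computable_all G `{encodable G} A `{encodable A} (p : G -> pred A) (s : G -> seq A) :
  computable (fun q : G * A => p q.1 q.2) -> computable s ->
  computable (fun c => all (p c) (s c)).
Proof.
move=> cp cs.
apply: (computable_ext (f := fun c => foldr (fun a b => p c a && b) true (s c))) => //.
apply: computable_foldr cs; last exact: computable_true.
apply: computable_andb; last exact/computable_snd/computable_id.
exact: (computable_comp cp (computable_fst computable_id)).
Qed.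

Lemma computable_mem G `{encodable G} (A : eqType) {eA : encodable A} {iA : encoding_inj A}
    (f : G -> A) (s : G -> seq A) :
  computable f -> computable s -> computable (fun c => f c \in s c).
Proof.
move=> cf cs; apply: (computable_ext (f := fun c => has (fun a => a == f c) (s c))).
  by move=> c; rewrite -has_pred1.
apply: computable_has cs; apply: computable_eq; first exact/computable_snd/computable_id.
exact: (computable_comp cf (computable_fst computable_id)).
Qed.

Lemma computable_index G `{encodable G} (A : eqType) {eA : encodable A} {iA : encoding_inj A}
    (f : G -> A) (s : G -> seq A) :
  computable f -> computable s -> computable (fun c => index (f c) (s c)).
Proof.
move=> cf cs.
apply: (computable_ext (f := fun c => foldr (fun a i => if a == f c then 0 else i.+1) 0 (s c))).
  by move=> c; elim: (s c) => //= x u ->.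
apply: computable_foldr cs; last exact: computable_0.
apply: computable_if; [apply: computable_eq|exact: computable_0|apply: computable_S].
- exact/computable_snd/computable_fst/computable_id.
- exact: (computable_comp cf (computable_fst (computable_fst computable_id))).
- exact/computable_snd/computable_id.
Qed.

Lemma computable_iota0 G `{encodable G} (k : G -> nat) :
  computable k -> computable (fun c => iota 0 (k c)).
Proof.
move=> [P evP]; pose incr (t : seq nat) := 0 :: map S t.
apply: (computable_ext (f := fun c => foldr (fun (_ : tree) t => incr t) [::] (nseq (k c) Leaf))).
  by move=> c; elim: (k c) => //= i ->; rewrite /incr -(iotaDl 1).
apply: computable_foldr; last 2 first.
- exact: computable_nil.
(* A number has the same code as a list of that many leaves, so the program for [k] serves
   unchanged. *)
- exists P => c; move: (evP c); rewrite {2}/encode /encodable_nat.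
  by have -> : enc_nat (k c) = enc_seq id (nseq (k c) Leaf) by elim: (k c) => //= i ->.
apply: computable_cons computable_0 (computable_map _ (computable_snd computable_id)).
exact/computable_S/computable_snd/computable_id.
Qed.

(** The rule is chosen by the head of the function body, so an unfolded definition is reduced to
    functions already known to be computable. *)
Ltac computable_step := lazymatch goal with
  | |- computable (fun c => c) => apply: computable_id
  | H : computable ?f |- computable ?f => exact: H
  | |- computable fst => apply: (computable_fst computable_id)
  | |- computable snd => apply: (computable_snd computable_id)
  | |- computable (fun c => fst _) => apply: computable_fst
  | |- computable (fun c => snd _) => apply: computable_snd
  | |- computable (fun c => (_, _)) => apply: computable_pair
  | |- computable (fun c => [::]) => apply: computable_nil
  | |- computable (fun c => _ :: _) => apply: computable_cons
  | |- computable (fun c => 0) => apply: computable_0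
  | |- computable (fun c => S _) => apply: computable_S
  | |- computable (fun c => true) => apply: computable_true
  | |- computable (fun c => false) => apply: computable_false
  | |- computable (fun c => ~~ _) => apply: computable_negb
  | |- computable (fun c => _ && _) => apply: computable_andb
  | |- computable (fun c => _ || _) => apply: computable_orb
  | |- computable (fun c => _ ==> _) => apply: computable_implyb
  | |- computable (fun c => if _ then _ else _) => apply: computable_if
  | |- computable (fun c => _ == _) => apply: computable_eq
  | |- computable (fun c => _ \in _) => apply: computable_mem
  | |- computable (fun c => has _ _) => apply: computable_has
  | |- computable (fun c => all _ _) => apply: computable_all
  | |- computable (fun c => filter _ _) => apply: computable_filter
  | |- computable (fun c => map _ _) => apply: computable_map
  | |- computable (fun c => flatten _) => apply: computable_flatten
  | |- computable (fun c => _ ++ _) => apply: computable_cat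
  | |- computable (fun c => foldr _ _ _) => apply: computable_foldr
  | |- computable (fun c => index _ _) => apply: computable_index
  | |- computable (fun c => iota 0 _) => apply: computable_iota0
  | H : computable ?f |- computable (fun c => ?f _) => apply: (computable_comp H)
  end.
Tactic Notation "computability" "by" tactic(known) := repeat first [computable_step | known].
Tactic Notation "computability" := computability by fail.

(** * The algorithm *)

(** Letters lose their bound [n] here: the algorithm becomes one function on a fixed type, with [n]
    as part of its input. *)
Notation rletter := (nat * bool)%type.
Notation rword := (seq rletter).
Notation input := (nat * seq rword)%type.
Notation rclass := (seq rword).
Notation state := (seq (rclass * rclass) * (seq rclass * seq (rword * rword)))%type.

(** A subset of a fixed list is represented by a filter of it; every such filter occurs here, and
    equal subsets are equal lists. *)
Fixpoint sublists (T : Type) (s : seq T) : seq (seq T) :=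
  if s is x :: s' then sublists s' ++ map (cons x) (sublists s') else [:: [::]].

Fixpoint suffixes (T : Type) (s : seq T) : seq (seq T) :=
  s :: if s is _ :: s' then suffixes s' else [::].

Definition pairs (T : Type) (s : seq T) : seq (T * T) := [seq (a, b) | a <- s, b <- s].

Definition rinv (x : rletter) : rletter := (x.1, ~~ x.2).

Definition letters (n : nat) : seq rletter := [seq (i, b) | i <- iota 0 n, b <- [:: true; false]].

(* The vertex v stands for the coset vH; hence the edge labelled x leads from x :: v to v. *)
Definition verts (I : input) : seq rword :=
  [::] :: flatten [seq suffixes w | w <- I.2 ++ [seq [:: x] | x <- letters I.1]].

(** The second disjunct is an edge labelled [rinv x] read backwards. *)
Definition edge (v : rword) (x : rletter) (v' : rword) : bool :=
  (v == x :: v') || (v' == rinv x :: v).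

(** Reflexivity and the Euclidean law make [R] an equivalence, the third clause says that the
    quotient is folded, and the fourth closes the path of each generator into a loop at the base. *)
Definition is_cong (I : input) (R : seq (rword * rword)) : bool :=
  [&& all (fun v => (v, v) \in R) (verts I),
      all (fun p => all (fun q => (p.1 == q.1) ==> ((p.2, q.2) \in R)) R) R,
      all (fun p => all (fun q => all (fun x =>
        edge p.1 x q.1 && edge p.2 x q.2 ==> (q \in R)) (letters I.1)) (pairs (verts I))) R
    & all (fun g => (g, [::]) \in R) I.2].

Definition congs (I : input) : seq (seq (rword * rword)) :=
  [seq R <- sublists (pairs (verts I)) | is_cong I R].

Definition rcls (I : input) (v : rword) : rclass :=
  [seq v' <- verts I | all (fun R => (v, v') \in R) (congs I)].

Definition classes (I : input) : seq rclass := [seq rcls I v | v <- verts I].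

Definition class_edge (c : rclass) (x : rletter) (c' : rclass) : bool :=
  has (fun v => has (fun v' => edge v x v') c') c.

(* Identifying c and c' folds every edge at the base vertex to a loop. *)
Definition good (I : input) (c c' : rclass) : bool :=
  all (fun R => has (fun v => has (fun v' => (v, v') \in R) c') c ==>
                all (fun x => ([:: x], [::]) \in R) (letters I.1)) (congs I).

Definition short_words (n : nat) : seq rword := [::] :: [seq [:: x] | x <- letters n].

(* The vertex l remembers the last letter read: a word w is cyclically reduced
   iff w labels a path from l to l for some l, with l = [::] when w is empty. *)
Definition last_edge (l : rword) (x : rletter) (l' : rword) : bool :=
  [&& l' == [:: x], l != [::] & l != [:: rinv x]].

(** Composition of relations. Being a filter of [pairs D], the result lies in [sublists (pairs D)],
    which keeps [states] closed under [step]. *)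
Definition rel_step (T : eqType) (D : seq T) (e : T -> T -> bool) (R : seq (T * T)) :=
  [seq p <- pairs D | has (fun m => ((p.1, m) \in R) && e m p.2) D].

Definition class_step (I : input) (x : rletter) (A : seq (rclass * rclass)) :=
  rel_step (classes I) (fun c c' => class_edge c x c') A.

(** Either the jump was made earlier and [x] is read after it, or it is made now, after [x]. In the
    second case [A] must already include [x], so [step] passes the updated relation. *)
Definition split_step (I : input) (x : rletter) (A : seq (rclass * rclass)) (B : seq rclass) :=
  [seq c' <- classes I | has (fun c =>
    (c \in B) && class_edge c x c' || ((rcls I [::], c) \in A) && good I c c') (classes I)].

Definition last_step (I : input) (x : rletter) (C : seq (rword * rword)) :=
  rel_step (short_words I.1) (fun l l' => last_edge l x l') C.

(* After reading w, a state (A, (B, C)) consists of the pairs of classes joined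
   by w, the classes reached from the base by pq where w = pq and one jumps
   between p and q across a good pair, and the pairs joined by w in the graph
   [last_edge]. *)
Definition start (I : input) : state :=
  ([seq p <- pairs (classes I) | p.1 == p.2],
    ([seq c <- classes I | good I (rcls I [::]) c],
     [seq p <- pairs (short_words I.1) | p.1 == p.2])).

Definition step (I : input) (q : state) (x : rletter) : state :=
  (class_step I x q.1,
    (split_step I x (class_step I x q.1) q.2.1, last_step I x q.2.2)).

Definition states (I : input) : seq state :=
  [seq (A, BC) | A <- sublists (pairs (classes I)),
    BC <- [seq (B, C) | B <- sublists (classes I), C <- sublists (pairs (short_words I.1))]].

(* S is a set of classes, closed under A, that contains the successors of the
   base but not the base. *)
Definition no_return (I : input) (A : seq (rclass * rclass)) : bool :=
  has (fun S => [&& rcls I [::] \notin S,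
                    all (fun p => (p.1 == rcls I [::]) ==> (p.2 \in S)) A
                  & all (fun p => (p.1 \in S) ==> (p.2 \in S)) A])
      (sublists (classes I)).

(** No edge of [last_edge] leaves [[::]], so the pair of empty words marks the empty word. That word
    is accepted separately: it generates the trivial subgroup, although it returns to the base. *)
Definition accepting (I : input) (q : state) : bool :=
  [&& rcls I [::] \in q.2.1,
      has (fun l => (l, l) \in q.2.2) (short_words I.1)
    & (([::], [::]) \in q.2.2) || no_return I q.1].

Definition raw_automaton (I : input) : seq nat * (seq nat * seq (nat * (rletter * nat))) :=
  ([:: index (start I) (states I)],
   ([seq index q (states I) | q <- states I & accepting I q],
    [seq (index q (states I), (x, index (step I q x) (states I))) |
      q <- states I, x <- letters I.1])).

(** * Computability of the construction *)

Lemma computable_sublists G {eG : encodable G} A {eA : encodable A} (s : G -> seq A) :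
  computable s -> computable (fun c => sublists (s c)).
Proof.
move=> cs; apply: (computable_ext
  (f := fun c => foldr (fun x ss => ss ++ map (cons x) ss) [:: [::]] (s c))).
  by move=> c; elim: (s c) => //= x t ->.
computability.
Qed.

Lemma computable_suffixes G {eG : encodable G} A {eA : encodable A} (s : G -> seq A) :
  computable s -> computable (fun c => suffixes (s c)).
Proof.
move=> cs; apply: (computable_ext
  (f := fun c => (foldr (fun x (p : seq A * seq (seq A)) => (x :: p.1, (x :: p.1) :: p.2))
                        ([::], [:: [::]]) (s c)).2)).
  move=> c; rewrite [X in X.2](_ : _ = (s c, suffixes (s c))) //.
  by elim: (s c) => //= x t ->.
by computability.
Qed.

Lemma computable_pairs G {eG : encodable G} A {eA : encodable A} (s : G -> seq A) :
  computable s -> computable (fun c => pairs (s c)).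
Proof.
move=> cs; rewrite /pairs; computability.
Qed.

Lemma computable_letters G {eG : encodable G} (n : G -> nat) :
  computable n -> computable (fun c => letters (n c)).
Proof. by move=> cn; rewrite /letters; computability. Qed.

Lemma computable_edge G {eG : encodable G} (v v' : G -> rword) (x : G -> rletter) :
  computable v -> computable x -> computable v' ->
  computable (fun c => edge (v c) (x c) (v' c)).
Proof. by move=> *; rewrite /edge /rinv; computability. Qed.

Lemma computable_class_edge G {eG : encodable G} (c c' : G -> rclass) (x : G -> rletter) :
  computable c -> computable x -> computable c' ->
  computable (fun a => class_edge (c a) (x a) (c' a)).
Proof.
by move=> *; rewrite /class_edge; computability by (apply: computable_edge).
Qed.

Lemma computable_last_edge G {eG : encodable G} (l l' : G -> rword) (x : G -> rletter) :
  computable l -> computable x -> computable l' ->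
  computable (fun c => last_edge (l c) (x c) (l' c)).
Proof. by move=> *; rewrite /last_edge /rinv; computability. Qed.

Ltac computable_known := idtac; lazymatch goal with
  | |- computable (fun c => suffixes _) => apply: computable_suffixes
  | |- computable (fun c => sublists _) => apply: computable_sublists
  | |- computable (fun c => pairs _) => apply: computable_pairs
  | |- computable (fun c => letters _) => apply: computable_letters
  | |- computable (fun c => edge _ _ _) => apply: computable_edge
  | |- computable (fun c => class_edge _ _ _) => apply: computable_class_edge
  | |- computable (fun c => last_edge _ _ _) => apply: computable_last_edge
  end.

Lemma computable_verts : computable verts.
Proof. by rewrite /verts; computability by computable_known. Qed.

Lemma computable_congs : computable congs.
Proof.
have cverts := computable_verts.
by rewrite /congs /is_cong; computability by computable_known.
Qed.

Lemma computable_rcls G {eG : encodable G} (I : G -> input) (v : G -> rword) :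
  computable I -> computable v -> computable (fun c => rcls (I c) (v c)).
Proof.
have cverts := computable_verts; have ccongs := computable_congs => cI cv.
by rewrite /rcls; computability.
Qed.

Lemma computable_classes : computable classes.
Proof.
have cverts := computable_verts.
by rewrite /classes; computability by (apply: computable_rcls).
Qed.

Lemma computable_good G {eG : encodable G} (I : G -> input) (c c' : G -> rclass) :
  computable I -> computable c -> computable c' ->
  computable (fun a => good (I a) (c a) (c' a)).
Proof.
have ccongs := computable_congs => cI cc cc'.
by rewrite /good; computability by computable_known.
Qed.

Lemma computable_short_words G {eG : encodable G} (n : G -> nat) :
  computable n -> computable (fun c => short_words (n c)).
Proof. by move=> cn; rewrite /short_words; computability by computable_known. Qed.

Lemma computable_states : computable states.
Proof.
have cclasses := computable_classes.
by rewrite /states; computability by first [computable_known | apply: computable_short_words].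
Qed.

Lemma computable_start : computable start.
Proof.
have cclasses := computable_classes.
by rewrite /start; computability by
  first [computable_known | apply: computable_short_words
        | apply: computable_good | apply: computable_rcls].
Qed.

Lemma computable_step G {eG : encodable G} (I : G -> input) (q : G -> state) (x : G -> rletter) :
  computable I -> computable q -> computable x ->
  computable (fun c => step (I c) (q c) (x c)).
Proof.
have cclasses := computable_classes => cI cq cx.
by rewrite /step /class_step /split_step /last_step /rel_step; computability by
  first [computable_known | apply: computable_short_words
        | apply: computable_good | apply: computable_rcls].
Qed.

Lemma computable_accepting G {eG : encodable G} (I : G -> input) (q : G -> state) :
  computable I -> computable q -> computable (fun c => accepting (I c) (q c)).
Proof.
have cclasses := computable_classes => cI cq.
by rewrite /accepting /no_return; computability by
  first [computable_known | apply: computable_short_words | apply: computable_rcls].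
Qed.

Lemma computable_raw_automaton : computable raw_automaton.
Proof.
have cstates := computable_states; have cstart := computable_start.
by rewrite /raw_automaton; computability by
  first [computable_known | apply: computable_step | apply: computable_accepting].
Qed.

(** * Folded graphs *)

Local Open Scope group_scope.
Local Open Scope classical_set_scope.

(** * Subgroups and generation *)

Lemma is_subgroupP (G : groupType) (H : set G) :
  is_subgroup H <-> H 1 /\ (forall x y, H x -> H y -> H (x / y)).
Proof.
split=> [[H1 HB]|[H1 HB]].
  by split=> [|x y Hx Hy]; [rewrite inE in H1|move: (HB x y); rewrite !inE; apply].
by split=> [|x y]; rewrite !inE //; apply: HB.
Qed.

Section Subgroup.

Context (G : groupType) (H : set G) (sgH : is_subgroup H).

Lemma subgroup1 : H 1. Proof. by case/is_subgroupP: sgH. Qed.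

Lemma subgroupF x y : H x -> H y -> H (x / y).
Proof. by case/is_subgroupP: sgH => _; apply. Qed.

Lemma subgroupV x : H x -> H x^-1.
Proof. by move=> Hx; rewrite -[_^-1]mul1g; apply: subgroupF => //; apply: subgroup1. Qed.

Lemma subgroupM x y : H x -> H y -> H (x * y).
Proof. by move=> Hx Hy; rewrite -[y]invgK; apply: subgroupF => //; apply: subgroupV. Qed.

Lemma subgroupX x k : H x -> H (x ^+ k).
Proof.
move=> Hx; elim: k => [|k IHk]; first by rewrite expg0; apply: subgroup1.
by rewrite expgS; apply: subgroupM.
Qed.

End Subgroup.

Lemma gen_subgroup (G : groupType) (X : set G) : is_subgroup (gen X).
Proof.
apply/is_subgroupP; split=> [K [sgK _]|x y gx gy K KX]; first exact: subgroup1.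
by apply: subgroupF; [case: KX|apply: gx|apply: gy].
Qed.

Lemma gen_sub (G : groupType) (X K : set G) : is_subgroup K -> X `<=` K -> gen X `<=` K.
Proof. exact: smallest_sub. Qed.

Lemma sub_gen (G : groupType) (X : set G) : X `<=` gen X.
Proof. exact: sub_gen_smallest. Qed.

Lemma gen_set1P (G : groupType) (u x : G) :
  gen [set u] x -> exists k, x = u ^+ k \/ x = (u ^+ k)^-1.
Proof.
(* Quotients of natural powers are closed under division without any distinction of signs. *)
move=> /(@gen_sub _ _ [set y | exists i j, y = u ^+ i / u ^+ j]) [||i [j ->]].
- apply/is_subgroupP; split=> [|_ _ [i [j ->]] [k [l ->]]].
    by exists 0, 0; rewrite mulgV.
  exists (i + l)%N, (j + k)%N; rewrite invgM invgK !expgnDr invgM -!mulgA; congr (_ * _).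
  have cuu a b : commute (u ^+ a) (u ^+ b) by apply: commuteX2.
  rewrite [RHS]mulgA; apply/commute_sym/commuteV/commute_sym/commuteM => //.
  exact/commuteV.
- by move=> _ ->; exists 1%N, 0; rewrite expg0 expg1 invg1 mulg1.
case: (leqP i j) => [le_ij|/ltnW le_ji].
  by exists (j - i)%N; right; rewrite expgnFr // invgM invgK.
by exists (i - j)%N; left; rewrite expgnFr.
Qed.

(** * Inverse graphs, their paths and their extensions *)

Section FoldedGraphs.

Context {n : nat}.

(** Inverse graphs in the sense of Stallings: since every edge has its inverse, determinism makes
    each letter act as a partial injection. *)
Record folded (X : Type) (e : X -> letter n -> X -> Prop) : Prop := Folded {
  edgeV : forall p x q, e p x q -> e q (inv_letter x) p;
  edge_det : forall p x q q', e p x q -> e p x q' -> q = q'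
}.

Fixpoint run (X : Type) (e : X -> letter n -> X -> Prop)
    (p : X) (w : seq (letter n)) (q : X) : Prop :=
  if w is x :: w' then exists2 r, e p x r & run e r w' q else p = q.

Section Run.

Context (X : Type) (e : X -> letter n -> X -> Prop).

Lemma run_cat p u v q : run e p (u ++ v) q <-> exists2 r, run e p u r & run e r v q.
Proof.
elim: u p => [|x u IHu] p /=; first by split=> [|[r ->]] //; exists p.
split=> [[r epr /IHu[s rs sq]]|[s [r epr rs] sq]]; first by exists s => //; exists r.
by exists r => //; apply/IHu; exists s.
Qed.

Lemma run_rcons p w x q : run e p (rcons w x) q <-> exists2 r, run e p w r & e r x q.
Proof.
rewrite -cats1 run_cat; split=> [[r pr /= [s ers <-]]|[r pr erq]]; exists r => //.
by exists q.
Qed.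

Hypothesis fe : folded e.

Lemma run_inv p w q : run e p w q -> run e q (inv_word w) p.
Proof.
rewrite /inv_word; elim: w p => [|x w IHw] p /=; first by move->.
move=> [r epr /IHw rq]; rewrite rev_cons; apply/run_rcons; exists r => //.
exact: edgeV.
Qed.

(** If [x] cancels against the next letter, determinism forces the second edge to retrace the first,
    so both can be removed. *)
Lemma run_push p x w q : run e p (x :: w) q -> run e p (push x w) q.
Proof.
case: w => [|y w] //= [r epr [s ers rs]]; case: eqP => [eq_y|_]; last first.
  by exists r => //; exists s.
by rewrite -(_ : s = p) //; apply: edge_det (edgeV fe epr); rewrite // -eq_y.
Qed.

Lemma run_reduce p w q : run e p w q -> run e p (reduce w) q.
Proof.
elim: w p => [|x w IHw] p //= [r epr /IHw rq].
by apply: run_push; exists r.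
Qed.

Lemma run_subgroup p : is_subgroup [set g : free_group n | run e p g p].
Proof.
apply/is_subgroupP; split=> // g h pg ph /=.
by apply: run_reduce; apply/run_cat; exists p => //; apply: run_inv.
Qed.

End Run.

(** New edges may also join old vertices; the point is that no two old vertices are merged. *)
Definition extension (X Y : Type) (e : X -> letter n -> X -> Prop)
    (f : Y -> letter n -> Y -> Prop) (i : X -> Y) : Prop :=
  [/\ folded f, injective i & forall p x q, e p x q -> f (i p) x (i q)].

Lemma extension_run X Y e f (i : X -> Y) p w q :
  extension e f i -> run e p w q -> run f (i p) w (i q).
Proof.
case=> _ _ ef; elim: w p => [|x w IHw] p /=; first by move->.
by move=> [r /ef epr /IHw rq]; exists (i r).
Qed.

Lemma extension_trans X Y Z e f g (i : X -> Y) (j : Y -> Z) :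
  extension e f i -> extension f g j -> extension e g (j \o i).
Proof.
move=> [_ injf ef] [fg injg eg]; split=> //; first exact: inj_comp.
by move=> p x q /ef /eg.
Qed.

Definition add_edge X (e : X -> letter n -> X -> Prop) P x Q p y q : Prop :=
  [\/ e p y q, [/\ p = P, y = x & q = Q] | [/\ p = Q, y = inv_letter x & q = P]].

Lemma add_edge_extension X (e : X -> letter n -> X -> Prop) P x Q :
  folded e -> (forall r, ~ e P x r) -> (forall r, ~ e r x Q) ->
  extension e (add_edge e P x Q) id.
Proof.
move=> [eV e_det] noP noQ.
have noQ' r : ~ e Q (inv_letter x) r by move/eV; rewrite inv_letterK; apply: noQ.
split=> //; last by move=> p y q epq; constructor 1.
split=> [p y q [/eV|[-> -> ->]|[-> -> ->]]|p y q q'].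
- by constructor 1.
- by constructor 3.
- by rewrite inv_letterK; constructor 2.
case=> [epq|[-> -> ->]|[-> -> ->]] [epq'|[eP ex ->]|[eQ ex ->]] //.
- exact: e_det epq epq'.
- by case: (noP q); rewrite -eP -ex.
- by case: (noQ' q); rewrite -eQ -ex.
- by case: (noP q').
- by case: (noQ' q').
Qed.

Definition add_vertex X (e : X -> letter n -> X -> Prop) (p : option X) y (q : option X) : Prop :=
  match p, q with Some p', Some q' => e p' y q' | _, _ => False end.

Lemma add_vertex_extension X (e : X -> letter n -> X -> Prop) :
  folded e -> extension e (add_vertex e) Some.
Proof.
move=> [eV e_det]; split=> // [|p q [] //].
split=> [[p|] y [q|] //=|[p|] y [q|] [q'|] //=]; first exact: eV.
by move=> epq epq'; congr Some; apply: e_det epq epq'.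
Qed.

(** The arc is built from [P] onwards: a fresh vertex [None] receives the edge labelled [x], and the
    rest of the word is attached from there by induction on its length. *)
Lemma add_arc X (e : X -> letter n -> X -> Prop) P x w Q :
  folded e -> reduced (x :: w) ->
  (forall r, ~ e P x r) -> (forall r, ~ e r (last x w) Q) ->
  exists Y (f : Y -> letter n -> Y -> Prop) (i : X -> Y),
    extension e f i /\ run f (i P) (x :: w) (i Q).
Proof.
have [m] := ubnP (size w); elim: m => // m IHm in X e P x w Q *.
case: w => [|y w] /= le_wm fe red_w noP noQ.
  exists X, (add_edge e P x Q), id; split; first exact: add_edge_extension.
  by exists Q => //; constructor 2.
have fev := add_vertex_extension fe.
have fe1 : extension (add_vertex e) (add_edge (add_vertex e) (Some P) x None) id.
  by apply: add_edge_extension; [case: fev|move=> [r /noP|] []|move=> [r|] []].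
move: fe1; set e1 := add_edge _ _ _ _ => fe1; have fe01 := extension_trans fev fe1.
have [fe1' _ _] := fe1.
have e1PN : e1 (Some P) x None by constructor 2.
have e1N z r : e1 None z r -> z = inv_letter x /\ r = Some P by case=> [|[]|[]].
have e1N' z r : e1 r z None -> z = x /\ r = Some P.
  by move/(edgeV fe1')/e1N => -[/(can_inj (@inv_letterK n))-> ->].
have /andP[neq_yx red_yw] := red_w.
have noN r : ~ e1 None y r by move/e1N => [eq_yx _]; rewrite eq_yx eqxx in neq_yx.
(* The new edge enters [Q] with the last label of the word only if [P = Q] and the word is a
   conjugate by [x]. Then the last letter runs back along the new edge, and the middle part is
   attached as a loop at [None]. *)
have [[eq_PQ eq_last]|neq] := pselect (P = Q /\ last y w = inv_letter x).
  case/lastP: w => [|w z] in le_wm red_w red_yw eq_last noQ *.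
    by rewrite /= in eq_last; rewrite eq_last eqxx in neq_yx.
  rewrite last_rcons in eq_last; rewrite eq_last {z eq_last} in le_wm red_w red_yw noQ *.
  (* Only [x] enters [None], and the middle part cannot end in [x] because [inv_letter x] follows it
     in a reduced word. *)
  have noN' r : ~ e1 r (last y w) None.
    move/e1N' => [eq_last _]; move: red_yw.
    by rewrite /reduced /= rcons_path eq_last eqxx andbF.
  have [||Y [f [i [ext_i run_i]]]] := IHm _ e1 None y w None _ fe1' _ noN noN'.
  - by rewrite size_rcons in le_wm; apply: ltnW.
  - by move: red_yw; rewrite /reduced /= rcons_path => /andP[].
  exists Y, f, (i \o Some); split; first exact: extension_trans fe01 ext_i.
  have [ff _ e1f] := ext_i.
  exists (i None); first exact: (e1f _ _ _ e1PN).
  suff : run f (i None) (rcons (y :: w) (inv_letter x)) ((i \o Some) Q) by [].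
  apply/run_rcons; exists (i None) => //.
  by rewrite /= -eq_PQ; apply: (edgeV ff); apply: e1f.
have noQ1 r : ~ e1 r (last y w) (Some Q).
  case: r => [r|]; first by case=> [/noQ//|[]//|[]//].
  by case=> [|[]|[_ eq_last [eq_QP]]] //; case: neq.
have [//|//|Y [f [i [ext_i run_i]]]] := IHm _ e1 None y w (Some Q) _ fe1' _ noN noQ1.
exists Y, f, (i \o Some); split; first exact: extension_trans fe01 ext_i.
by have [_ _ e1f] := ext_i; exists (i None); first exact: (e1f _ _ _ e1PN).
Qed.

(** Letters are stripped from either end of [w] as long as the graph reads them. If [w] is
    exhausted, it splits; otherwise both ends are blocked, which is what [add_arc] requires of the
    remaining word. *)
Lemma split_or_extend X (e : X -> letter n -> X -> Prop) P w Q :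
  folded e -> reduced w ->
  (exists u v R S, [/\ w = u ++ v, run e P u R & run e S v Q]) \/
  (exists Y (f : Y -> letter n -> Y -> Prop) (i : X -> Y),
    extension e f i /\ run f (i P) w (i Q)).
Proof.
move=> fe; have [m] := ubnP (size w); elim: m => // m IHm in P w Q *.
case: w => [|x w]; first by move=> _ _; left; exists [::], [::], P, Q.
rewrite [size _]/= ltnS => le_wm red_w.
have [[P' ePP']|noP] := pselect (exists r, e P x r).
  have [[u [v [R [S [-> PR SQ]]]]]|[Y [f [i [ext_i fPQ]]]]] :=
    IHm P' w Q le_wm (reduced_cons red_w).
    by left; exists (x :: u), v, R, S; split=> //; exists P'.
  right; exists Y, f, i; split=> //; exists (i P') => //.
  by case: ext_i => _ _; apply.
have [[Q' eQQ']|noQ] := pselect (exists r, e r (last x w) Q); last first.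
  right; apply: add_arc => // r er; [by apply: noP; exists r|by apply: noQ; exists r].
have eq_w : x :: w = rcons (belast x w) (last x w) by apply: lastI.
have red_b : reduced (belast x w).
  by move: red_w; rewrite eq_w /reduced -cats1 => /cat_sorted2[].
have le_bm : (size (belast x w) < m)%N by rewrite size_belast.
have [[u [v [R [S [eq_b PR SQ]]]]]|[Y [f [i [ext_i fPQ]]]]] := IHm P (belast x w) Q' le_bm red_b.
  left; exists u, (rcons v (last x w)), R, S; split=> //.
    by rewrite eq_w eq_b rcons_cat.
  by apply/run_rcons; exists Q'.
right; exists Y, f, i; split=> //.
suff : run f (i P) (x :: w) (i Q) by [].
rewrite eq_w.
by apply/run_rcons; exists (i Q') => //; case: ext_i => _ _; apply.
Qed.

End FoldedGraphs.

(** * Congruences on the vertices *)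

Lemma mem_sublists (T : eqType) (p : pred T) (s : seq T) : filter p s \in sublists s.
Proof.
elim: s => //= x s IHs; rewrite mem_cat; case: (p x); last by rewrite IHs.
by rewrite map_f ?orbT.
Qed.

Lemma sublists_sub (T : eqType) (s t : seq T) : t \in sublists s -> {subset t <= s}.
Proof.
elim: s t => [|x s IHs] t /=; first by rewrite inE => /eqP->.
rewrite mem_cat => /orP[/IHs ts y /ts|/mapP[u /IHs us ->] y].
  by rewrite inE orbC => ->.
by rewrite !inE => /orP[->//|/us->]; rewrite orbT.
Qed.

Lemma mem_pairs (T : eqType) (s : seq T) a b : ((a, b) \in pairs s) = (a \in s) && (b \in s).
Proof.
apply/allpairsP/andP => [[[a' b'] [/= sa sb [-> ->]]]//|[sa sb]].
by exists (a, b).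
Qed.

Lemma self_suffixes (T : eqType) (w : seq T) : w \in suffixes w.
Proof. by case: w => [|x w] /=; rewrite mem_head. Qed.

Lemma behead_suffixes (T : eqType) (w : seq T) x v : x :: v \in suffixes w -> v \in suffixes w.
Proof.
elim: w => [|y w IHw] //=; rewrite !inE => /orP[/eqP[_ ->]|/IHw->].
  by rewrite self_suffixes orbT.
by rewrite orbT.
Qed.

(** * Raw words and their values in the free group *)

Section Letters.

Context {n : nat}.

Definition raw (x : letter n) : rletter := (nat_of_ord x.1, x.2).

Definition unraw (y : rletter) : option (letter n) := omap (fun i => (i, y.2)) (insub y.1).

Lemma rawK : pcancel raw unraw.
Proof. by case=> i b; rewrite /unraw /= valK. Qed.

Lemma raw_inv x : raw (inv_letter x) = rinv (raw x).
Proof. by []. Qed.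

Lemma mem_letters x : raw x \in letters n.
Proof.
case: x => i b; apply/allpairsP; exists (nat_of_ord i, b).
by rewrite mem_iota /= add0n ltn_ord; case: b.
Qed.

Lemma lettersP y : y \in letters n -> exists x, y = raw x.
Proof.
case/allpairsP=> -[i b]; rewrite mem_iota /= => -[lt_in _ ->].
by exists (Ordinal lt_in, b).
Qed.

Definition fg_letter (x : letter n) : free_group n := @FreeGroup n [:: x] isT.

(** Letters with index outside the range are dropped, so that every raw word has a value. *)
Definition value (v : rword) : free_group n := FreeGroup (reduce_reduced (pmap unraw v)).

Lemma value_nil : value [::] = 1.
Proof. by apply: val_inj. Qed.

Lemma value_cons x v : value (raw x :: v) = fg_letter x * value v.
Proof. by apply: val_inj; rewrite /= rawK -[RHS]/(reduce ([:: x] ++ _)) reduce_catr. Qed.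

Lemma value_word (u : free_group n) : value (map raw u) = u.
Proof. by apply: val_inj; rewrite /= (map_pK rawK) reduce_id // (valP u). Qed.

Lemma fg_letterV x : fg_letter (inv_letter x) = (fg_letter x)^-1.
Proof. by apply: val_inj. Qed.

Lemma value_edge v x v' : edge v (raw x) v' -> value v = fg_letter x * value v'.
Proof.
case/orP=> /eqP->; first by rewrite value_cons.
by rewrite -raw_inv value_cons fg_letterV mulVKg.
Qed.

Lemma subgroup_letters (K : set (free_group n)) :
  is_subgroup K -> (forall x, K (fg_letter x)) -> K = [set: free_group n].
Proof.
move=> sgK Kx; apply/seteqP; split=> // u _; rewrite -[u]value_word.
elim: (word_of u) => [|x w IHw] /=; first by rewrite value_nil; apply: subgroup1.
by rewrite value_cons; apply: subgroupM.
Qed.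

End Letters.

Section Congruences.

Context {n : nat} (s : seq (free_group n)).

Definition raw_input : input := (n, [seq map raw (word_of g) | g <- s]).

Local Notation I := raw_input.
Local Notation V := (verts raw_input).

Lemma nil_verts : [::] \in V. Proof. exact: mem_head. Qed.

Lemma gen_verts (g : free_group n) : g \in s -> map raw g \in V.
Proof.
move=> sg; rewrite inE; apply/orP; right; apply/flatten_mapP; exists (map raw g).
  by rewrite mem_cat (map_f (fun g : free_group n => map raw g)).
exact: self_suffixes.
Qed.

Lemma letter_verts (x : letter n) : [:: raw x] \in V.
Proof.
rewrite inE; apply/orP; right; apply/flatten_mapP; exists [:: raw x].
  by rewrite mem_cat (map_f (fun x => [:: x])) ?orbT ?mem_letters.
exact: self_suffixes.
Qed.

Lemma behead_verts y v : y :: v \in V -> v \in V.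
Proof.
rewrite inE /= => /flatten_mapP[w sw /behead_suffixes wv].
by rewrite inE; apply/orP; right; apply/flatten_mapP; exists w.
Qed.

Record congruence (R : rel rword) : Prop := Congruence {
  cong_sub : forall v v', R v v' -> v \in V /\ v' \in V;
  cong_refl : forall v, v \in V -> R v v;
  cong_eucl : forall a b c, R a b -> R a c -> R b c;
  cong_edge : forall (x : letter n) a a' b b', R a b -> a' \in V -> b' \in V ->
    edge a (raw x) a' -> edge b (raw x) b' -> R a' b';
  cong_gen : forall g, g \in s -> R (map raw g) [::]
}.

Lemma cong_sym R a b : congruence R -> R a b -> R b a.
Proof.
move=> cR Rab; apply: (cong_eucl cR Rab); apply: (cong_refl cR).
by case: (cong_sub cR Rab).
Qed.

Lemma mem_congs_cong R : R \in congs I -> congruence (fun a b => (a, b) \in R).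
Proof.
rewrite mem_filter => /andP[/and4P[/allP Rrefl /allP Reucl /allP Redge /allP Rgen]].
move=> /sublists_sub sR.
have subR v v' : (v, v') \in R -> v \in V /\ v' \in V by move/sR; rewrite mem_pairs => /andP.
split=> // [a b c Rab Rac|x a a' b b' Rab Va' Vb' aa' bb'|g sg].
- by have /allP/(_ _ Rac) := Reucl _ Rab; rewrite eqxx.
- have /allP/(_ (a', b')) := Redge _ Rab; rewrite mem_pairs Va' Vb' => /(_ isT).
  by move/allP/(_ _ (mem_letters x)); rewrite /= aa' bb'.
- by apply: Rgen; apply: (map_f (fun g : free_group n => map raw g)).
Qed.

(** A congruence relates vertices only, so it is a filter of [pairs V]: the enumeration misses
    none. *)
Lemma cong_mem_congs R : congruence R ->
  exists2 R', R' \in congs I & forall a b, ((a, b) \in R') = R a b.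
Proof.
move=> cR; have memR a b : ((a, b) \in [seq p <- pairs V | R p.1 p.2]) = R a b.
  rewrite mem_filter mem_pairs /=; case Rab: (R a b) => //.
  by case: (cong_sub cR Rab) => -> ->.
exists [seq p <- pairs V | R p.1 p.2] => //.
rewrite mem_filter mem_sublists andbT; apply/and4P; split.
- by apply/allP=> v Vv; rewrite memR (cong_refl cR).
- apply/allP=> -[a b]; rewrite memR => Rab; apply/allP=> -[a' c]; rewrite !memR => Rac.
  by apply/implyP=> /eqP eqa; apply: (cong_eucl cR Rab); rewrite (eqa : a = a').
- apply/allP=> -[a b]; rewrite memR => Rab; apply/allP=> -[a' b'].
  rewrite mem_pairs => /andP[Va' Vb']; apply/allP=> y /lettersP[x ->].
  by apply/implyP=> /andP[aa' bb']; rewrite memR (cong_edge cR Rab Va' Vb' aa' bb').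
- by apply/allP=> _ /mapP[g sg ->]; rewrite memR (cong_gen cR).
Qed.

Definition min_cong : rel rword :=
  fun a b => [&& a \in V, b \in V & all (fun R => (a, b) \in R) (congs I)].

Lemma min_cong_le R a b : congruence R -> min_cong a b -> R a b.
Proof. by move/cong_mem_congs=> [R' cR' <-] /and3P[_ _ /allP]; apply. Qed.

Lemma min_cong_cong : congruence min_cong.
Proof.
split=> [a b /and3P[]//|v Vv|a b c /and3P[_ Vb /allP ab] /and3P[_ Vc /allP ac]|x a a' b b'|g sg].
- by rewrite /min_cong Vv; apply/allP=> R /mem_congs_cong cR; apply: (cong_refl cR).
- rewrite /min_cong Vb Vc; apply/allP=> R cR.
  exact: (cong_eucl (mem_congs_cong cR) (ab _ cR) (ac _ cR)).
- move=> /and3P[_ _ /allP ab] Va' Vb' aa' bb'; rewrite /min_cong Va' Vb'; apply/allP=> R cR.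
  exact: (cong_edge (mem_congs_cong cR) (ab _ cR) Va' Vb' aa' bb').
- rewrite /min_cong gen_verts // nil_verts; apply/allP=> R /mem_congs_cong cR.
  exact: (cong_gen cR sg).
Qed.

(** The relation is equality of the cosets [value v] K. It contains the least congruence, which
    turns paths of the folded graph into membership in K; this is applied to K = H and to K = <H,
    u>. *)
Lemma subgroup_cong (K : set (free_group n)) :
  is_subgroup K -> (forall g, g \in s -> K g) ->
  congruence (fun a b => [&& a \in V, b \in V & `[< K ((value a)^-1 * value b) >]]).
Proof.
move=> sgK Ks; split.
- by move=> a b /and3P[].
- by move=> v Vv; rewrite Vv /=; apply/asboolP; rewrite mulVg; apply: subgroup1.
- move=> a b c /and3P[_ Vb /asboolP ab] /and3P[_ Vc /asboolP ac].
  rewrite Vb Vc; apply/asboolP.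
  have := subgroupM sgK (subgroupV sgK ab) ac.
  by rewrite invgM invgK mulgA mulgK.
- move=> x a a' b b' /and3P[_ _ /asboolP ab] Va' Vb' /value_edge aa' /value_edge bb'.
  rewrite Va' Vb'; apply/asboolP; move: ab.
  by rewrite aa' bb' invgM -mulgA mulKg.
- move=> g sg; rewrite gen_verts // nil_verts; apply/asboolP.
  by rewrite value_word value_nil mulg1; apply: subgroupV => //; apply: Ks.
Qed.

(** * The quotient graph of a congruence *)

Section Quotient.

Context (R : rel rword) (cR : congruence R).

Definition cls (v : rword) : rclass := [seq v' <- V | R v v'].

Lemma cls_eqP a b : a \in V -> b \in V -> reflect (cls a = cls b) (R a b).
Proof.
move=> Va Vb; apply: (iffP idP) => [Rab|eq_ab].
  apply: eq_filter => c; apply/idP/idP => [Rac|Rbc]; first exact: (cong_eucl cR Rab Rac).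
  exact: (cong_eucl cR (cong_sym cR Rab) Rbc).
have : b \in cls b by rewrite mem_filter (cong_refl cR).
by rewrite -eq_ab mem_filter => /andP[].
Qed.

Definition cls_edge (c : rclass) (x : letter n) (c' : rclass) : Prop :=
  exists a b, [/\ a \in V, b \in V, c = cls a, c' = cls b & edge a (raw x) b].

Lemma edge_inv a x b : edge a (raw x) b -> edge b (raw (@inv_letter n x)) a.
Proof. by rewrite /edge raw_inv orbC; case: x => i e; rewrite /rinv /= negbK. Qed.

(** Determinism is [cong_edge], applied to two representatives of the source class. *)
Lemma cls_edge_folded : folded cls_edge.
Proof.
split=> [c x c' [a [b [Va Vb -> -> ab]]]|c x c1 c2].
  by exists b, a; split=> //; apply: edge_inv.
move=> [a [a' [Va Va' -> -> aa']]] [b [b' [Vb Vb' /cls_eqP-/(_ Va Vb) ab -> bb']]].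
by apply/cls_eqP => //; apply: (cong_edge cR ab) aa' bb'.
Qed.

Lemma run_suffix w : map raw w \in V -> run cls_edge (cls (map raw w)) w (cls [::]).
Proof.
elim: w => [|x w IHw] //= Vw; have Vw' := behead_verts Vw.
exists (cls (map raw w)); last exact: IHw.
by exists (raw x :: map raw w), (map raw w); split=> //; rewrite /edge eqxx.
Qed.

(** A generator labels the path through its own suffixes, from its vertex to the empty word, and the
    congruence identifies these two ends. *)
Lemma run_gens (g : free_group n) : gen [set` s] g -> run cls_edge (cls [::]) g (cls [::]).
Proof.
apply: (gen_sub (run_subgroup cls_edge_folded _)) => h sh /=.
have Vh := gen_verts sh.
have /(cls_eqP Vh nil_verts) {1}<- := cong_gen cR sh.
exact: run_suffix.
Qed.

(** The base has an edge labelled by the inverse of [x] to the vertex [[:: raw x]], and by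
    hypothesis also one to itself; determinism identifies the ends. *)
Lemma run_letters : (forall g : free_group n, run cls_edge (cls [::]) g (cls [::])) ->
  forall x : letter n, R [:: raw x] [::].
Proof.
move=> runw x; apply/cls_eqP; rewrite ?nil_verts ?letter_verts //.
have [c ec eq_c] := run_inv cls_edge_folded (run_suffix (letter_verts x : map raw [:: x] \in V)).
have [c' ec' eq_c'] := runw (fg_letter (inv_letter x)).
rewrite -[RHS](eq_c' : c' = _) -[LHS](eq_c : c = cls [:: raw x]).
exact: (edge_det cls_edge_folded ec ec').
Qed.

End Quotient.
End Congruences.

(** * Cocycles *)

Section Cocycles.

Context {n : nat} (s : seq (free_group n)).

Local Notation I := (raw_input s).
Local Notation V := (verts (raw_input s)).
Local Notation mcls := (cls s (min_cong s)).
Local Notation medge := (@cls_edge n s (min_cong s)).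

Lemma rclsE v : v \in V -> rcls I v = mcls v.
Proof. by move=> Vv; apply: eq_in_filter => v' Vv'; rewrite /min_cong Vv Vv'. Qed.

Lemma goodP a b : a \in V -> b \in V -> good I (mcls a) (mcls b) <->
  forall R, congruence s R -> R a b -> forall x : letter n, R [:: raw x] [::].
Proof.
have cM := min_cong_cong s.
move=> Va Vb; split=> [/allP gab R /cong_mem_congs[R' cR' R'E] Rab x|gab].
  have /implyP/(_ _)/allP := gab _ cR'; rewrite -R'E; apply; last exact: mem_letters.
  apply/hasP; exists a; first by rewrite mem_filter Va (cong_refl cM).
  apply/hasP; exists b; first by rewrite mem_filter Vb (cong_refl cM).
  by rewrite R'E.
apply/allP=> R /mem_congs_cong cR; apply/implyP=> /hasP[a' aa' /hasP[b' bb' Rab']].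
apply/allP=> _ /lettersP[x ->]; apply: (gab _ cR).
move: aa' bb'; rewrite !mem_filter => /andP[/(min_cong_le cR) aa' _] /andP[/(min_cong_le cR) bb' _].
apply: (cong_eucl cR (cong_sym cR aa')).
exact: (cong_eucl cR (cong_sym cR Rab') (cong_sym cR bb')).
Qed.

Lemma run_cls R a w c : congruence s R -> a \in V ->
  run (@cls_edge n s R) (cls s R a) w c -> exists2 b, b \in V & c = cls s R b.
Proof.
move=> cR; elim: w a => [|x w IHw] a Va /=; first by exists a.
by move=> [_ [_ [b [_ Vb _ -> _]]]]; apply: IHw.
Qed.

Lemma run_min_cong R a w b : congruence s R -> a \in V -> b \in V ->
  run medge (mcls a) w (mcls b) -> run (@cls_edge n s R) (cls s R a) w (cls s R b).
Proof.
have cM := min_cong_cong s.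
move=> cR; elim: w a => [|x w IHw] a Va Vb /=.
  by move/(cls_eqP cM Va Vb)/(min_cong_le cR)/(cls_eqP cR Va Vb).
move=> [_ [a' [b' [Va' Vb' /(cls_eqP cM Va Va') aa' -> ab']]] /(IHw _ Vb' Vb) rb].
exists (cls s R b') => //; exists a', b'; split=> //.
exact/(cls_eqP cR Va Va')/(min_cong_le cR aa').
Qed.

(** Along an edge labelled [x], the coset of the source is [x] times the coset of the target, modulo
    K; these relations compose along the path. *)
Lemma run_value (K : set (free_group n)) a w b :
  is_subgroup K -> (forall g, g \in s -> K g) -> a \in V -> b \in V ->
  run medge (mcls a) w (mcls b) -> K ((value a)^-1 * value (map raw w) * value b).
Proof.
have cM := min_cong_cong s.
move=> sgK Ks; have cK := subgroup_cong sgK Ks.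
elim: w a => [|x w IHw] a Va Vb /=.
  by move=> /(cls_eqP cM Va Vb)/(min_cong_le cK)/and3P[_ _ /asboolP]; rewrite value_nil mulg1.
move=> [_ [a' [b' [Va' Vb' /(cls_eqP cM Va Va') aa' -> /value_edge ab']]] /(IHw _ Vb' Vb) Kb].
move: aa' => /(min_cong_le cK)/and3P[_ _ /asboolP Kaa'].
have := subgroupM sgK Kaa' Kb; rewrite ab' value_cons.
by rewrite !mulgA mulgK.
Qed.

Lemma value_cat (v w : rword) : value (v ++ w) = value v * value w :> free_group n.
Proof. by apply: val_inj; rewrite /= pmap_cat reduce_catl reduce_catr. Qed.

(** For the direct implication, [u] either splits along readable pieces or can be added as an arc.
    The converse applies goodness to the coset congruence of <H, u>. *)
Lemma gen_addP (u : free_group n) :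
  gen (gen [set` s] `|` [set u]) = [set: free_group n] <->
  exists p q a b, [/\ word_of u = p ++ q, a \in V /\ b \in V, good I (mcls a) (mcls b),
    run medge (mcls [::]) p (mcls a) & run medge (mcls b) q (mcls [::])].
Proof.
have cM := min_cong_cong s; have fM := cls_edge_folded cM; have V0 := nil_verts s.
split=> [genT|[p [q [a [b [uE [Va Vb] /(goodP Va Vb) gab pa bq]]]]]].
  (* Labels of loops at [P] form a subgroup, so a folded graph that reads H and [u] at [P] reads the
     whole group there. *)
  have stab (X : Type) (e : X -> letter n -> X -> Prop) P : folded e ->
      (forall g, g \in s -> run e P (word_of g) P) ->
      run e P u P -> forall g : free_group n, run e P g P.
    move=> fe Ps Pu g; have : gen (gen [set` s] `|` [set u]) g by rewrite genT.
    apply: (gen_sub (run_subgroup fe P)) => h [|->] //.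
    exact: (gen_sub (run_subgroup fe P)).
  have gens R (cR : congruence s R) g : g \in s ->
      run (@cls_edge n s R) (cls s R [::]) g (cls s R [::]).
    by move=> sg; apply: (run_gens cR); apply: sub_gen.
  suff [p [q [c [d [uE pc dq]]]]] : exists p q c d, [/\ word_of u = p ++ q,
      run medge (mcls [::]) p c & run medge d q (mcls [::])].
    have [a Va eq_c] := run_cls cM V0 pc; have [b Vb eq_d] := run_cls cM V0 (run_inv fM dq).
    rewrite {}eq_c in pc; rewrite {}eq_d in dq.
    (* In the quotient by a congruence that identifies [a] and [b], the paths [p] and [q] join into
       a loop labelled [u]. *)
    exists p, q, a, b; split=> //; apply/(goodP Va Vb) => R cR Rab.
    apply: (run_letters cR); apply: stab; [exact: cls_edge_folded|exact: gens|].
    rewrite uE; apply/run_cat; exists (cls s R a); first exact: run_min_cong.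
    by move/(cls_eqP cR Va Vb): Rab => ->; apply: run_min_cong.
  have [[p [q [c [d [uE pc dq]]]]]|[Y [f [i [ext_i Pu]]]]] :=
      split_or_extend (mcls [::]) (mcls [::]) fM (valP u); first by exists p, q, c, d.
  have [ff inj_i ef] := ext_i.
  (* After adding the arc, every letter labels a loop at the base. The original graph already had an
     edge with that letter there, and no vertices were merged, so the original edge is a loop; hence
     the original graph reads [u]. *)
  exists u, [::], (mcls [::]), (mcls [::]); rewrite cats0; split=> //.
  have allP : forall g : free_group n, run f (i (mcls [::])) g (i (mcls [::])).
    by apply: stab => // g sg; apply: extension_run ext_i _; apply: gens.
  have loop x : medge (mcls [::]) x (mcls [::]).
    have Vx := letter_verts s (inv_letter x).
    have [c ec eq_c] := run_suffix (min_cong s) (Vx : map raw [:: _] \in V).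
    rewrite (eq_c : c = _) in ec; move/(edgeV fM): ec; rewrite inv_letterK => ec.
    have [c' ec' eq_c'] := allP (fg_letter x); rewrite (eq_c' : c' = _) in ec'.
    suff {2}-> : mcls [::] = mcls [:: raw (inv_letter x)] by [].
    by apply: inj_i; apply: (edge_det ff ec'); apply: ef.
  by elim: (word_of u) => [|x w IHw] //=; exists (mcls [::]).
set K := gen _; have sgK : is_subgroup K by apply: gen_subgroup.
have Ks g : g \in s -> K g by move=> sg; apply: sub_gen; left; apply: sub_gen.
have Ku : K u by apply: sub_gen; right.
have Kp := run_value sgK Ks V0 Va pa; have Kq := run_value sgK Ks Vb V0 bq.
rewrite value_nil ?invg1 ?mulg1 ?mul1g in Kp Kq.
apply: subgroup_letters => // x.
(* With values written for vertices, a^-1 b is the product of (p a)^-1, u = p q and (b^-1 q)^-1, all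
   three in K. *)
have Kab : [&& a \in V, b \in V & `[< K ((value a)^-1 * value b) >]].
  rewrite Va Vb; apply/asboolP.
  have := subgroupF sgK (subgroupM sgK (subgroupV sgK Kp) Ku) Kq.
  rewrite -[u]value_word uE map_cat value_cat !invgM invgK !mulgA mulgVK.
  by rewrite mulgK.
have /and3P[_ _ /asboolP] := gab _ (subgroup_cong sgK Ks) Kab x.
by rewrite (value_cons x [::]) value_nil !mulg1 => /(subgroupV sgK); rewrite invgK.
Qed.

(** Together with [run_gens], this identifies the labels of closed paths at the base with H. *)
Lemma run_genP w : run medge (mcls [::]) w (mcls [::]) -> gen [set` s] (value (map raw w)).
Proof.
have V0 := nil_verts s => /(run_value (gen_subgroup [set` s]) _ V0 V0).
by rewrite value_nil invg1 mul1g mulg1; apply=> g sg; apply: sub_gen.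
Qed.

(** Consecutive copies of [w] meet at its last and first letters, where cyclic reducedness forbids
    cancellation. *)
Lemma reduced_power (w : seq (letter n)) k :
  cyclically_reduced w -> reduced (flatten (nseq k w)).
Proof.
case: w => [|x w]; first by elim: k.
rewrite /cyclically_reduced /reduced => /andP[/= red_w neq_x].
elim: k => //= k IHk; rewrite cat_path red_w.
case: k IHk => //= k ->; rewrite andbT.
by apply: contraNneq neq_x => eq_x; rewrite [X in inv_letter X]eq_x inv_letterK.
Qed.

Lemma value_power (u : free_group n) k : value (map raw (flatten (nseq k (word_of u)))) = u ^+ k.
Proof.
elim: k => [|k IHk] /=; first by rewrite value_nil expg0.
by rewrite map_cat value_cat IHk value_word expgS.
Qed.

Lemma word_power (u : free_group n) k :
  cyclically_reduced u -> word_of (u ^+ k) = flatten (nseq k (word_of u)).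
Proof.
by move=> cu; rewrite -value_power /= (map_pK rawK) reduce_id // reduced_power.
Qed.

(** Powers of [u] are concatenations of its word, so membership of a positive power in H is a return
    to the base. The empty word returns at once and is treated apart. *)
Lemma cap_cyclicP (u : free_group n) : cyclically_reduced u ->
  gen [set` s] `&` gen [set u] = [set 1] <->
  word_of u = [::] \/
  forall k, ~ run medge (mcls [::]) (flatten (nseq k.+1 (word_of u))) (mcls [::]).
Proof.
move=> cu; have cM := min_cong_cong s; have sgH := gen_subgroup [set` s].
have sgU := gen_subgroup [set u].
split=> [capE|no_power].
  have [u0|nu0] := pselect (word_of u = [::]); [by left|right=> k /run_genP].
  rewrite value_power => Huk; apply: nu0.
  have : (gen [set` s] `&` gen [set u]) (u ^+ k.+1).
    by split=> //; apply: (subgroupX sgU); apply: sub_gen.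
  by rewrite capE => /= /(congr1 (@word_of n)); rewrite word_power //=; case: (word_of u).
apply/seteqP; split=> [x [Hx /gen_set1P[k xE]]|_ ->]; last by split; apply: subgroup1.
(* H is closed under inverses, so the exponent may be taken nonnegative. *)
have Huk : gen [set` s] (u ^+ k).
  by case: xE Hx => -> // /(subgroupV sgH); rewrite invgK.
have uk1 : u ^+ k = 1.
  case: no_power => [u0|no_power].
    by rewrite (_ : u = 1) ?expg1n //; apply: val_inj.
  case: k xE Huk => [|k] _; first by rewrite expg0.
  by move=> /(run_gens cM); rewrite word_power // => /no_power.
by case: xE; rewrite uk1 ?invg1.
Qed.

End Cocycles.

(** * The recognizing automaton *)

Section Recognition.

Context {n : nat} (s : seq (free_group n)).

Local Notation I := (raw_input s).
Local Notation V := (verts (raw_input s)).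
Local Notation mcls := (cls s (min_cong s)).
Local Notation medge := (@cls_edge n s (min_cong s)).
Local Notation base := (rcls (raw_input s) [::]).
Local Notation state_of w := (foldl (step (raw_input s)) (start (raw_input s)) (map (@raw n) w)).

Lemma mem_classes c : (c \in classes I) <-> exists2 v, v \in V & c = mcls v.
Proof.
split=> [/mapP[v Vv ->]|[v Vv ->]]; first by exists v; rewrite ?rclsE.
by rewrite -rclsE // map_f.
Qed.

Lemma base_classes : base \in classes I.
Proof. by apply: map_f; apply: nil_verts. Qed.

Lemma class_edgeP c x c' : c \in classes I -> c' \in classes I ->
  class_edge c (raw x) c' <-> medge c x c'.
Proof.
have cM := min_cong_cong s.
move=> /mem_classes[a Va ->] /mem_classes[b Vb ->]; split.
  move=> /hasP[a' aa' /hasP[b' bb' ab']].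
  move: aa' bb'; rewrite !mem_filter => /andP[aa' Va'] /andP[bb' Vb'].
  by exists a', b'; split=> //; apply/(cls_eqP cM).
move=> [a' [b' [Va' Vb' /(cls_eqP cM Va Va') aa' /(cls_eqP cM Vb Vb') bb' ab']]].
apply/hasP; exists a'; rewrite ?mem_filter ?aa' //.
by apply/hasP; exists b'; rewrite ?mem_filter ?bb'.
Qed.

Lemma run_classes c w c' : c \in classes I -> run medge c w c' -> c' \in classes I.
Proof.
move=> /mem_classes[v Vv ->] /(run_cls (min_cong_cong s) Vv) [v' Vv' ->].
by apply/mem_classes; exists v'.
Qed.

Lemma start_relP (T : eqType) (D : seq T) a b :
  (a, b) \in [seq p <- pairs D | p.1 == p.2] <-> [/\ a \in D, b \in D & a = b].
Proof.
rewrite mem_filter mem_pairs /=; split=> [/and3P[/eqP ab Da Db]|[Da Db ->]]; first by split.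
by rewrite eqxx Db.
Qed.

(** Serves both relations in the state. The third hypothesis keeps the last intermediate vertex of a
    path inside [D], where [rel_step] looks for it. *)
Lemma rel_stepP (T : eqType) (D : seq T) (e : T -> letter n -> T -> Prop)
    (eb : T -> T -> bool) R w x :
  (forall a b, a \in D -> b \in D -> eb a b <-> e a x b) ->
  (forall a b, (a, b) \in R <-> [/\ a \in D, b \in D & run e a w b]) ->
  (forall a b, a \in D -> run e a w b -> b \in D) ->
  forall a b, (a, b) \in rel_step D eb R <-> [/\ a \in D, b \in D & run e a (rcons w x) b].
Proof.
move=> ebP RP De a b; rewrite mem_filter mem_pairs; split.
  move=> /and3P[/hasP[m Dm /andP[/RP[_ _ am] mb]] Da Db]; split=> //.
  by apply/run_rcons; exists m => //; apply/(ebP _ _ Dm Db).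
move=> [Da Db /run_rcons[m am mb]]; have Dm := De _ _ Da am.
apply/and3P; split=> //; apply/hasP; exists m => //; apply/andP; split; first exact/RP.
exact/ebP.
Qed.

Lemma class_relP w c c' :
  (c, c') \in (state_of w).1 <-> [/\ c \in classes I, c' \in classes I & run medge c w c'].
Proof.
elim/last_ind: w c c' => [|w x IHw] c c'; first exact: start_relP.
rewrite map_rcons foldl_rcons; apply: rel_stepP => [a b|a b|a b]; first exact: class_edgeP.
- exact: IHw.
- exact: run_classes.
Qed.

Lemma splitP w c : c \in (state_of w).2.1 <->
  exists p q a b, [/\ w = p ++ q, [/\ a \in classes I, b \in classes I & c \in classes I],
    good I a b, run medge base p a & run medge b q c].
Proof.
elim/last_ind: w c => [|w x IHw] c.
  rewrite -[_.2.1]/[seq c <- classes I | good I base c] mem_filter.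
  split=> [/andP[gc Xc]|[p [q [a [b [pq [_ _ Xc]]]]]]].
    by exists [::], [::], base, c; split=> //; split=> //; apply: base_classes.
  by case: p q pq => [|? ?] [|? ?] // _ gab /= eq_a eq_b; rewrite Xc andbT eq_a -eq_b.
rewrite map_rcons foldl_rcons mem_filter; split=> [/andP[/hasP[m Xm] + Xc]|].
  move=> /orP[/andP[/IHw[p [q [a [b [-> [Xa Xb _] gab pa bm]]]]] /(class_edgeP _ Xm Xc) mc]|].
    exists p, (rcons q x), a, b; split=> //; first by rewrite rcons_cat.
    by apply/run_rcons; exists m.
  have /= := class_relP (rcons w x) base m; rewrite map_rcons foldl_rcons /= => relE.
  move=> /andP[/relE[_ _ wm] gmc].
  by exists (rcons w x), [::], m, c; split=> //; rewrite cats0.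
move=> [p [q [a [b [wE [Xa Xb Xc] gab pa]]]]]; rewrite Xc andbT.
(* If [q] is empty, the jump comes after the last letter; otherwise [q] ends in [x], and the jump is
   already recorded for [w]. *)
case/lastP: q wE => [|q y]; rewrite ?cats0.
  move=> wE cE; rewrite -{}wE in pa; rewrite (cE : b = c) in gab.
  apply/hasP; exists a => //.
  have /= := class_relP (rcons w x) base a; rewrite map_rcons foldl_rcons /= => relE.
  by apply/orP; right; rewrite gab andbT; apply/relE; split=> //; apply: base_classes.
rewrite -rcons_cat => /rcons_inj[wE <-] /run_rcons[m bm mc].
have Xm := run_classes Xb bm; apply/hasP; exists m => //.
apply/orP; left; apply/andP; split; last exact/class_edgeP.
by apply/IHw; exists p, q, a, b.
Qed.

Definition letter_edge (l : rword) (x : letter n) (l' : rword) : Prop := last_edge l (raw x) l'.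

Lemma letter_edge_short l x l' : letter_edge l x l' -> l' \in short_words n.
Proof.
case/and3P=> /eqP-> _ _; rewrite inE; apply/orP; right.
by apply: (map_f (fun y => [:: y])); apply: mem_letters.
Qed.

Lemma last_relP w l l' : (l, l') \in (state_of w).2.2 <->
  [/\ l \in short_words n, l' \in short_words n & run letter_edge l w l'].
Proof.
elim/last_ind: w l l' => [|w x IHw] l l'; first exact: start_relP.
rewrite map_rcons foldl_rcons; apply: rel_stepP => [a b _ _|a b|a b]; [exact: iff_refl|exact: IHw|].
case/lastP: w {IHw} => [Da <- //|w y] _ /run_rcons[m _].
exact: letter_edge_short.
Qed.

(** The vertex carries exactly the letter against which [reduced] checks the next one. *)
Lemma run_letter_edge y w l :
  run letter_edge [:: raw y] w l <-> reduced (y :: w) /\ l = [:: raw (last y w)].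
Proof.
elim: w y => [|x w IHw] y /=; first by split=> [<-|[]].
have neqE : ([:: raw y] != [:: rinv (raw x)]) = (x != inv_letter y).
  rewrite -raw_inv !eqseq_cons andbT (inj_eq (pcan_inj rawK)).
  by rewrite -(inj_eq (can_inj (@inv_letterK n))) inv_letterK eq_sym.
rewrite /reduced /=; split.
  by move=> [_ /and3P[/eqP-> _]]; rewrite neqE => -> /IHw[].
move=> [/andP[nxy red_w] lE]; exists [:: raw x]; last exact/IHw.
by rewrite /letter_edge /last_edge eqxx neqE.
Qed.

Lemma cyclically_reducedP w :
  has (fun l => (l, l) \in (state_of w).2.2) (short_words n) <-> cyclically_reduced w.
Proof.
case: w => [|x w].
  by split.
split=> [/hasP[l Ll /last_relP[_ _]]|].
  move: Ll; rewrite inE => /orP[/eqP->|/mapP[_ /lettersP[y ->] ->]].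
    by move=> [m /and3P[]].
  move=> /run_letter_edge [/= /andP[nxy red_w] /(congr1 (head (raw y)))/(pcan_inj rawK) yE].
  rewrite /cyclically_reduced /reduced /= red_w; apply: contraNneq nxy => eq_l.
  by rewrite yE eq_l inv_letterK.
move=> /andP[red_w neq_l]; apply/hasP.
(* Starting from the last letter of the word, the first edge tests that it is not inverse to the
   first letter. *)
have Ll : [:: raw (last x w)] \in short_words n.
  by rewrite inE; apply/orP; right; apply: (map_f (fun y => [:: y])); apply: mem_letters.
exists [:: raw (last x w)] => //; apply/last_relP; split=> //; apply/run_letter_edge; split=> //.
apply/andP; split; last exact: red_w.
apply: contraNneq neq_l => xE.
by rewrite [X in inv_letter X]xE inv_letterK.
Qed.

Lemma emptyP w : (([::], [::]) \in (state_of w).2.2) <-> w = [::].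
Proof.
split=> [/last_relP[_ _]|->]; first by case: w => // x w [m /and3P[]].
by apply/last_relP.
Qed.

Lemma run_power w k c : run medge base (flatten (nseq k.+1 w)) c <->
  exists2 m, run medge base (flatten (nseq k w)) m & run medge m w c.
Proof.
have -> : flatten (nseq k.+1 w) = flatten (nseq k w) ++ w.
  by rewrite -addn1 nseqD flatten_cat /= cats0.
exact: run_cat.
Qed.

Lemma no_returnP w : no_return I (state_of w).1 <->
  forall k, ~ run medge base (flatten (nseq k.+1 w)) base.
Proof.
have X0 := base_classes.
split=> [/hasP[S XS /and3P[S0 /allP start_S /allP step_S]] k runk|no_return_w].
  suff : base \in S by apply/negP.
  suff runS c : run medge base (flatten (nseq k.+1 w)) c -> c \in S by apply: runS.
  elim: k {runk} c => [|k IHk] c /run_power[m bm mc].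
    move: bm => /= bm; rewrite -{m}bm in mc.
    have /class_relP/start_S/implyP : [/\ base \in classes I, c \in classes I & run medge base w c].
      by split=> //; apply: run_classes mc.
    exact.
  have Xm := run_classes X0 bm.
  have /class_relP/step_S/implyP : [/\ m \in classes I, c \in classes I & run medge m w c].
    by split=> //; apply: run_classes mc.
  by apply; apply: IHk.
(* The least possible invariant set: the classes reached from the base by positive powers of [w]. *)
apply/hasP; exists [seq c <- classes I | `[< exists k, run medge base (flatten (nseq k.+1 w)) c >]].
  exact: mem_sublists.
apply/and3P; split.
- by rewrite mem_filter X0 andbT; apply/asboolP => -[k /no_return_w].
- apply/allP=> -[c c'] /class_relP[Xc Xc' cc']; apply/implyP=> /eqP cE.
  rewrite mem_filter Xc' andbT; apply/asboolP; exists 0.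
  by apply/run_power; exists base; rewrite // -[X in run _ X]cE.
- apply/allP=> -[c c'] /class_relP[Xc Xc' cc']; apply/implyP.
  rewrite !mem_filter => /andP[/asboolP[k bc] _]; rewrite Xc' andbT.
  by apply/asboolP; exists k.+1; apply/run_power; exists c.
Qed.

Lemma acceptingP w : accepting I (state_of w) <->
  exists2 u : free_group n, (coc_oplus (gen [set` s]) `&` @cyc_reduced_set n) u & word_of u = w.
Proof.
have V0 := nil_verts s; have base_cls := rclsE V0.
split.
  move=> /and3P[/splitP[p [q [a [b [wE [Xa Xb _] gab pa bq]]]]] /cyclically_reducedP cw ret].
  have /andP[red_w _] := cw; exists (FreeGroup red_w) => //; split; last exact: cw.
  move: Xa Xb => /mem_classes[a' Va' aE] /mem_classes[b' Vb' bE].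
  split; last first.
    apply/(@cap_cyclicP n s (FreeGroup red_w) cw); rewrite -base_cls.
    by case/orP: ret => [/emptyP|/no_returnP]; [left|right].
  apply/gen_addP; exists p, q, a', b'; rewrite -base_cls -aE -bE.
  by split.
move=> [u [[/gen_addP[p [q [a [b [uE [Va Vb] gab pa bq]]]]] capE] cu] <-].
apply/and3P; split.
- apply/splitP; exists p, q, (mcls a), (mcls b); rewrite base_cls.
  by split=> //; split; apply/mem_classes; [exists a|exists b|exists [::]].
- exact/cyclically_reducedP.
- move/(@cap_cyclicP n s u cu): capE; rewrite -base_cls.
  by case=> [/emptyP->//|/no_returnP->]; rewrite orbT.
Qed.

(** * Numbering of the states and encoding of the automaton *)

Lemma mem_states A B C : (A, (B, C)) \in states I =
  [&& A \in sublists (pairs (classes I)), B \in sublists (classes I)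
    & C \in sublists (pairs (short_words n))].
Proof.
apply/allpairsP/and3P => [[[A' BC] [/= AX]]|[AX BX CX]].
  by move=> /allpairsP[[B' C'] [/= BX CX ->]] [-> -> ->].
by exists (A, (B, C)); split=> //; apply/allpairsP; exists (B, C).
Qed.

Lemma start_states : start I \in states I.
Proof. by rewrite mem_states !mem_sublists. Qed.

Lemma step_states q x : step I q x \in states I.
Proof. by rewrite mem_states !mem_sublists. Qed.

Definition all_letters : seq (letter n) := [seq (i, b) | i <- enum 'I_n, b <- [:: true; false]].

Lemma mem_all_letters x : x \in all_letters.
Proof.
by case: x => i [|]; apply/allpairsP; [exists (i, true)|exists (i, false)]; rewrite mem_enum.
Qed.

Lemma map_raw_letters : letters n = map raw all_letters.
Proof. by rewrite /letters -val_enum_ord allpairs_mapl map_allpairs. Qed.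

(** The same data as [raw_automaton], with the bound restored on the letters. *)
Definition cocycle_automaton : automaton n :=
  Automaton [:: index (start I) (states I)]
    [seq index q (states I) | q <- states I & accepting I q]
    [seq (index q (states I), x, index (step I q (raw x)) (states I)) |
      q <- states I, x <- all_letters].

(** Outside the list [index] returns its length, so sharing the index of a member forces
    membership. *)
Lemma index_states_inj q r : q \in states I -> index q (states I) = index r (states I) -> q = r.
Proof.
move=> Qq eq_qr; have Qr : r \in states I by rewrite -index_mem -eq_qr index_mem.
by rewrite -(nth_index q Qq) eq_qr nth_index.
Qed.

(** The automaton is deterministic and complete on [states], so its only run follows [step]. *)
Lemma accepts_fromP q w : q \in states I ->
  accepts_from cocycle_automaton (index q (states I)) w <->
  accepting I (foldl (step I) q (map raw w)).
Proof.
elim: w q => [|x w IHw] q Qq /=.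
  split=> [/mapP[r]|acc_q]; last by apply: map_f; rewrite mem_filter acc_q.
  by rewrite mem_filter => /andP[acc_r _] /(index_states_inj Qq) ->.
have Qqx := step_states q (raw x); rewrite -(IHw _ Qqx); split=> [[j]|acc_w].
  by move=> /allpairsP[[r y] [/= _ _ [/(index_states_inj Qq)<- <- ->]]].
exists (index (step I q (raw x)) (states I)) => //.
by apply/allpairsP; exists (q, x); rewrite mem_all_letters.
Qed.

Lemma cocycle_automatonP :
  recognizes cocycle_automaton (coc_oplus (gen [set` s]) `&` @cyc_reduced_set n).
Proof.
move=> w; rewrite -acceptingP -(accepts_fromP _ start_states); split=> [[p]|acc_w].
  by rewrite inE => /eqP->.
by exists (index (start I) (states I)) => //; apply: mem_head.
Qed.

Lemma enc_seq_map (T U : Type) (enc : U -> tree) (f : T -> U) t :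
  enc_seq enc (map f t) = enc_seq (enc \o f) t.
Proof. by elim: t => //= x t ->. Qed.

(** The encoding of a letter forgets the bound on its index, so typed and raw words have the same
    trees. *)
Lemma enc_generatorsE : enc_generators s = encode I.
Proof.
congr Node; rewrite [RHS]enc_seq_map; congr foldr.
by apply/funext => g; apply/funext => t; congr Node; rewrite [RHS]enc_seq_map.
Qed.

Lemma enc_automatonE : enc_automaton cocycle_automaton = encode (raw_automaton I).
Proof.
pose f (e : nat * letter n * nat) := let: (p, x, q) := e in (p, (raw x, q)).
congr Node; congr Node.
transitivity (enc_seq encode (map f (transitions cocycle_automaton))).
  by rewrite enc_seq_map; congr foldr; apply/funext => -[[p x] q].
congr enc_seq; rewrite map_allpairs /= map_raw_letters.
by rewrite allpairs_mapr.
Qed.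

End Recognition.

Theorem corollary7p4 :
  (forall (n : nat) (H : set (free_group n)),
     is_subgroup H -> finitely_generated H ->
     rational (coc_oplus H `&` @cyc_reduced_set n))
  /\
  (exists P : prog, forall (n : nat) (s : seq (free_group n)),
     exists A : automaton n,
       eval P (enc_generators s) (enc_automaton A) /\
       recognizes A (coc_oplus (gen [set` s]) `&` @cyc_reduced_set n)).
Proof.
split=> [n H _ [s ->]|]; first by exists (cocycle_automaton s); apply: cocycle_automatonP.
have [P evP] := computable_raw_automaton; exists P => n s; exists (cocycle_automaton s).
split; last exact: cocycle_automatonP.
rewrite enc_generatorsE enc_automatonE; exact: evP.
Qed.
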